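(* For every integer $k\ge 2$, every string graph with $n$ vertices admits a $\frac{3}{4}(5^k-1)$-hop spanner of size $O(n\,\alpha_k(n))$.
   Context: A string graph is the intersection graph of a finite collection of curves in the plane: the vertices are the curves, and two vertices are adjacent iff the curves intersect. For a graph $G$ and integer $t\ge1$, a $t$-hop spanner is a subgraph $\widehat{G}$ of $G$ on the same vertex set such that for every edge $uv\in E(G)$ there is a $u$–$v$ path in $\widehat{G}$ with at most $t$ edges; its size is its number of edges. The functions $\alpha_k$ form the inverse Ackermann hierarchy: $\alpha_0(n)=n/2$, and for $k\ge1$, $\alpha_k(n)$ is the number of times $\alpha_{k-1}$ must be iteratively applied starting from $n$ to reach a value at most $1$; thus $\alpha_1(n)=\Theta(\log n)$, $\alpha_2(n)=\Theta(\log^* n)$, etc. *)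

(* Defs.v *)
From HB Require Import structures.
From mathcomp Require Import all_boot all_order all_algebra.
From mathcomp Require Import all_classical all_reals all_analysis.
From mathcomp Require Import Rstruct Rstruct_topology.
From Stdlib Require Rdefinitions.
Notation R := Rdefinitions.R.

Set Implicit Arguments.
Unset Strict Implicit.
Unset Printing Implicit Defensive.

Import Order.TTheory GRing.Theory Num.Theory.
Local Open Scope classical_set_scope.
Local Open Scope ring_scope.

Definition is_curve (c : R -> R * R) : Prop :=
  {within `[0%R, 1%R], continuous c}.

Definition curve_pts (c : R -> R * R) : set (R * R) := c @` `[0%R, 1%R].

Definition string_graph (V : finType) (G : rel V) : Prop :=
  (forall v, ~~ G v v) /\
  exists c : V -> (R -> R * R),
    (forall v, is_curve (c v)) /\
    (forall u v, u != v -> (G u v <-> curve_pts (c u) `&` curve_pts (c v) !=set0)).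

Definition num_edges (V : finType) (H : rel V) : nat :=
  #|[set e : {set V} | [exists u, exists v, H u v && (e == (finset.set1 u :|: finset.set1 v))]]|%N.

Definition hop_spanner (V : finType) (G H : rel V) (t : nat) : Prop :=
  symmetric H /\
  (forall u v, H u v -> G u v) /\
  (forall u v, G u v ->
     exists p : seq V, [/\ path H u p, last u p = v & (size p <= t)%N]).

Definition iter_count (f : R -> R) (x : R) : nat :=
  match pselect (exists i : nat, iter i f x <= 1) with
  | left H => ex_minn H
  | right _ => 0%N
  end.

Fixpoint alpha (k : nat) : R -> R :=
  match k with
  | 0%N => fun x => x / 2
  | k'.+1 => fun x => (iter_count (alpha k') x)%:R
  end.

(* Main.v *)
(* Discretizing the plane turns a string graph into an intersection graph of connected sets of
   grid points; this class is closed under contraction of connected sets of vertices.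

   Separators. For a suitable root r, the closed neighbourhood of four paths to r always
   halves the graph. Attach to each grid point x a grid walk pi_x to a common origin, blocked
   only by strings near one path P_a. If no four paths worked, then for each grid edge xy a
   connected set C with more than half of the vertices would avoid pi_x and pi_y, and the
   winding number modulo 2 of the closed walk pi_x xy pi_y around C would be well defined.
   These numbers sum to 0 around each unit square, hence around the boundary of the big
   square; but there they sum to 1.

   Spanners. With shortest paths, each vertex is near only boundedly many path vertices, so
   recursive halving gives 3-hop spanners of size O(n log n). Combined with breadth-first
   layers as in the Lipton-Tarjan theorem, halving also gives, for every j, a set S of
   O(n (3/4)^j) vertices whose closed neighbourhood leaves components of size at most 2^j.
   Contract the radius-2 clusters around S: a t-hop spanner of the contracted graph becomes a
   (5t+3)-hop cover of all edges near S. If the t-hop spanner has O(n a(n)) edges, taking 2^j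
   polynomial in a(n) makes the contracted one linear, and two such steps reduce the component
   size from n to at most max(M, a(n)); iterating yields the next level of the hierarchy. *)
From mathcomp Require Import all_boot zify boolp.
Set Implicit Arguments.
Unset Strict Implicit.
Unset Printing Implicit Defensive.

(** * Grid walks and winding parity *)

Definition pt := (nat * nat)%type.

Definition gadj : rel pt := fun p q =>
  (p.1 == q.1) && ((p.2 == q.2.+1) || (q.2 == p.2.+1)) ||
  (p.2 == q.2) && ((p.1 == q.1.+1) || (q.1 == p.1.+1)).

Lemma gadj_sym : symmetric gadj.
Proof. by move=> p q; rewrite /gadj; lia. Qed.

Definition gwalk (A : pred pt) (p q : pt) : Prop :=
  exists s, [/\ path gadj p s, last p s = q & all A (p :: s)].

Lemma gwalk_refl (A : pred pt) p : A p -> gwalk A p p.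
Proof. by move=> Ap; exists [::]; rewrite /= Ap. Qed.

Lemma gwalk_step (A : pred pt) p q : A p -> A q -> gadj p q -> gwalk A p q.
Proof. by move=> Ap Aq pq; exists [:: q]; rewrite /= Ap Aq pq. Qed.

Lemma gwalk_trans (A : pred pt) p q r : gwalk A p q -> gwalk A q r -> gwalk A p r.
Proof.
move=> [s [ps <- As]] [s' [ps' <- As']]; exists (s ++ s'); split.
- by rewrite cat_path ps.
- by rewrite last_cat.
- by move: As As'; rewrite /= all_cat => /andP[-> ->] /andP[_ ->].
Qed.

Lemma gwalk_sym (A : pred pt) p q : gwalk A p q -> gwalk A q p.
Proof.
move=> [s]; elim: s p => [|x s IH] p [/=].
  by move=> _ -> /andP[Aq _]; apply: gwalk_refl.
move=> /andP[px ps] lq /and3P[Ap Ax As].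
apply: (gwalk_trans (q := x)); first by apply: IH; rewrite ps lq /= Ax.
by apply: gwalk_step => //; rewrite gadj_sym.
Qed.

Lemma gwalk_sub (A B : pred pt) p q : subpred A B -> gwalk A p q -> gwalk B p q.
Proof. by move=> AB [s [ps lq As]]; exists s; split=> //; apply: sub_all As. Qed.

(* The step p p' crosses the ray that leaves q to the right, at height q.2 + 1/2. *)
Definition cr (q p p' : pt) := (q.1 < p.1) && ((q.2 < p.2) (+) (q.2 < p'.2)).

Fixpoint crw q p s := if s is p' :: s' then cr q p p' (+) crw q p' s' else false.

(* The change of the crossing parity of a walk when q moves to q' depends on the ends of the walk
   only, through this function. *)
Definition zeta (q q' p : pt) :=
  [&& q.1 == q'.1, q.1 < p.1 & (q.2 < p.2) (+) (q'.2 < p.2)].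

Variant gadj_spec (x y : nat) : pt -> Type :=
  | GadjR : gadj_spec x y (x.+1, y)
  | GadjL x' : x = x'.+1 -> gadj_spec x y (x', y)
  | GadjU : gadj_spec x y (x, y.+1)
  | GadjD y' : y = y'.+1 -> gadj_spec x y (x, y').

Lemma gadjP x y q : gadj (x, y) q -> gadj_spec x y q.
Proof.
case: q => x' y'; rewrite /gadj /=.
case: (eqVneq x x') => [->|_] /=; case: (eqVneq y y') => [->|_] /=.
- by rewrite !ltn_eqF.
- rewrite orbF; case: eqP => [-> _|_ /eqP ->]; by constructor.
- case: eqP => [-> _|_ /eqP ->]; by constructor.
- by [].
Qed.

(** Both moves are unit steps, so this is a check of directions. The identity can fail when the step
    starts or ends at the moving point, which the four inequalities exclude. *)
Lemma cr_move q q' p p' : gadj q q' -> gadj p p' ->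
  p != q -> p' != q -> p != q' -> p' != q' ->
  cr q p p' (+) cr q' p p' = zeta q q' p (+) zeta q q' p'.
Proof.
case: q q' p p' => [a b] q' [x y] p'; rewrite /cr /zeta.
case/gadjP => [|a' ->||b' ->]; case/gadjP => [|x' ->||y' ->]; rewrite !xpair_eqE /= => h1 h2 h3 h4.
all: lia.
Qed.

Lemma crw_cat q p s1 s2 : crw q p (s1 ++ s2) = crw q p s1 (+) crw q (last p s1) s2.
Proof. by elim: s1 p => //= x s1 IH p; rewrite IH addbA. Qed.

Lemma crw_move q q' p s : gadj q q' -> path gadj p s ->
  q \notin p :: s -> q' \notin p :: s ->
  crw q p s (+) crw q' p s = zeta q q' p (+) zeta q q' (last p s).
Proof.
move=> qq'; elim: s p => [|x s IH] p /=; first by rewrite addbb.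
move=> /andP[px ps]; rewrite inE negb_or => /andP[qp qs].
rewrite inE negb_or => /andP[q'p q's].
rewrite addbACA IH // cr_move // 1?eq_sym //.
- by rewrite addbA -[_ (+) _ (+) _ x]addbA addbb addbF.
- by apply: contraNneq qs => ->; rewrite mem_head.
- by apply: contraNneq q's => ->; rewrite mem_head.
Qed.

(** * Explicit walks along the axes and the boundary of the square *)

Fixpoint downs (i j : nat) : seq pt :=
  if j is j'.+1 then (i, j') :: downs i j' else [::].

Fixpoint lefts (i j : nat) : seq pt :=
  if i is i'.+1 then (i', j) :: lefts i' j else [::].

Lemma last_downs i j : last (i, j) (downs i j) = (i, 0).
Proof. by elim: j. Qed.

Lemma last_lefts i j : last (i, j) (lefts i j) = (0, j).
Proof. by elim: i. Qed.

Lemma path_downs i j : path gadj (i, j) (downs i j).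
Proof. by elim: j => //= j ->; rewrite /gadj /= !eqxx. Qed.

Lemma path_lefts i j : path gadj (i, j) (lefts i j).
Proof. by elim: i => //= i ->; rewrite /gadj /= !eqxx !orbT. Qed.

Lemma mem_downs i j p : p \in downs i j -> p.1 = i /\ p.2 < j.
Proof. by elim: j => //= j IH; rewrite inE => /orP[/eqP->//|/IH[-> /ltnW]]. Qed.

Lemma mem_lefts i j p : p \in lefts i j -> p.2 = j /\ p.1 < i.
Proof. by elim: i => //= i IH; rewrite inE => /orP[/eqP->//|/IH[-> /ltnW]]. Qed.

Lemma crw_downs q i j : crw q (i, j) (downs i j) = (q.1 < i) && (q.2 < j).
Proof.
elim: j => /= [|j ->]; first by rewrite andbF.
by rewrite /cr /=; case: (q.1 < i) => //=; rewrite -addbA addbb addbF.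
Qed.

Lemma crw_lefts q i j : crw q (i, j) (lefts i j) = false.
Proof. by elim: i => //= i ->; rewrite /cr /= addbb andbF. Qed.

(* Walks on the boundary of the square, slit at the top of its right side: only the edge
   (m, m - 1) - (m, m) closes up a cycle around the inside. *)
Definition rim_walk m (x : pt) : seq pt :=
  if (x.1 == m) && (x.2 < m) then downs x.1 x.2 ++ lefts x.1 0
  else lefts x.1 x.2 ++ downs 0 x.2.

Definition rim m (x : pt) := [|| x.1 == 0, x.2 == 0, x.1 == m | x.2 == m].

Definition rim_cr (q : pt) m (x : pt) := [&& x.1 == m, x.2 < m & q.2 < x.2].

Lemma path_rim_walk m x : path gadj x (rim_walk m x).
Proof.
case: x => i j; rewrite /rim_walk /=; case: ifP => _.
  by rewrite cat_path path_downs last_downs path_lefts.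
by rewrite cat_path path_lefts last_lefts path_downs.
Qed.

Lemma last_rim_walk m x : last x (rim_walk m x) = (0, 0).
Proof.
case: x => i j; rewrite /rim_walk /=; case: ifP => _.
  by rewrite last_cat last_downs last_lefts.
by rewrite last_cat last_lefts last_downs.
Qed.

Lemma crw_rim_walk q m x : q.1 < m -> crw q x (rim_walk m x) = rim_cr q m x.
Proof.
case: x => i j qm; rewrite /rim_walk /rim_cr /=; case: ifP => [/andP[/eqP-> ->]|].
  by rewrite crw_cat crw_downs last_downs crw_lefts addbF eqxx qm.
rewrite crw_cat crw_lefts last_lefts crw_downs ltn0.
by case: (i == m) => //= ->.
Qed.

Lemma mem_rim_walk m x p : rim m x -> x.1 <= m -> x.2 <= m ->
  p \in x :: rim_walk m x -> rim m p.
Proof.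
case: x => i j; rewrite /rim_walk /rim /= => ri im jm.
rewrite inE => /orP[/eqP->//|].
case: ifP => h; rewrite mem_cat => /orP[].
- by move=> /mem_downs[-> _]; move: h; lia.
- by move=> /mem_lefts[-> _]; rewrite eqxx orbT.
- by move=> /mem_lefts[-> pi]; move: ri h pi; lia.
- by move=> /mem_downs[-> _].
Qed.

(** Every inner edge lies on two unit squares, so it cancels modulo 2; [h] and [v] hold the values
    on horizontal and vertical edges. *)
Lemma stokes (m : nat) (h v : nat -> nat -> bool) :
  (forall i j, i < m -> j < m -> h i j (+) v i.+1 j (+) h i j.+1 (+) v i j = false) ->
  \big[addb/false]_(i < m) h i 0 (+) \big[addb/false]_(i < m) h i m =
  \big[addb/false]_(j < m) v 0 j (+) \big[addb/false]_(j < m) v m j.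
Proof.
move=> hv.
have row j : j < m -> \big[addb/false]_(i < m) h i j (+) \big[addb/false]_(i < m) h i j.+1
    = v 0 j (+) v m j.
  move=> jm; rewrite -big_split /=.
  suff row' k : k <= m -> \big[addb/false]_(i < k) (h i j (+) h i j.+1) = v 0 j (+) v k j.
    exact: row'.
  elim: k => [|k IH] km; first by rewrite big_ord0 addbb.
  rewrite big_ord_recr /= IH 1?ltnW // -addbA; congr addb.
  have := hv k j km jm.
  by case: (h k j); case: (v k.+1 j); case: (h k j.+1); case: (v k j).
rewrite -[RHS]big_split /=.
suff col k : k <= m -> \big[addb/false]_(i < m) h i 0 (+) \big[addb/false]_(i < m) h i k
   = \big[addb/false]_(j < k) (v 0 j (+) v m j) by exact: col.
elim: k => [|k IH] km; first by rewrite big_ord0 addbb.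
rewrite big_ord_recr /= -IH 1?ltnW // -row // addbA.
by rewrite -[in RHS](addbA (\big[_/_]_(i < m) h i 0)) addbb addbF.
Qed.

(** * The four-path separator *)

(** Only the vertices of [U] are represented, so passing to a subset keeps [V] and [G]. The open box
    leaves the boundary of the square free of strings. *)
Record grid_rep (V : finType) (U : {set V}) (G : rel V) (m : nat) (D : V -> pred pt) : Prop :=
  GridRep {
    rep_sym : symmetric G;
    rep_irr : irreflexive G;
    rep_box : forall v p, v \in U -> D v p -> (0 < p.1 < m) && (0 < p.2 < m);
    rep_ne : forall v, v \in U -> exists p, D v p;
    rep_conn : forall v p q, v \in U -> D v p -> D v q -> gwalk (D v) p q;
    rep_adj : forall u v, u \in U -> v \in U -> u != v ->
      (G u v <-> exists p, D u p /\ D v p) }.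

Definition restr (V : finType) (G : rel V) (A : {set V}) : rel V :=
  [rel x y | [&& x \in A, y \in A & G x y]].

Definition conn (V : finType) (G : rel V) (A : {set V}) : Prop :=
  {in A &, forall x y, connect (restr G A) x y}.

Definition closed_nbhd (V : finType) (G : rel V) (A : {set V}) : {set V} :=
  [set v | [exists a in A, (a == v) || G a v]].

Lemma path_restr (V : finType) (G : rel V) (A : {set V}) x s :
  path (restr G A) x s -> path G x s /\ {subset s <= A}.
Proof.
elim: s x => //= y s IH x /andP[/and3P[xA yA xy]] /IH[-> sA].
by rewrite xy; split=> // z; rewrite inE => /orP[/eqP->//|/sA].
Qed.

Section Separator.
Variables (V : finType) (U : {set V}) (G : rel V) (m : nat) (D : V -> pred pt).
Hypothesis rep : grid_rep U G m D.

Let Gsym := rep_sym rep.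

(** Adjacent strings share a grid point, where the walk changes from one to the next. *)
Lemma string_walk a s x y : a \in U -> {subset s <= U} -> path G a s ->
  D a x -> D (last a s) y -> gwalk (fun p => [exists v, (v \in a :: s) && D v p]) x y.
Proof.
elim: s a x => [|b s IH] a x aU sU /=.
  move=> _ Dx Dy; apply: gwalk_sub (rep_conn rep aU Dx Dy) => p Dp.
  by apply/existsP; exists a; rewrite mem_head.
move=> /andP[ab bs] Dx Dy.
have bU : b \in U by apply: sU; rewrite mem_head.
have ne : a != b by apply: contraTneq ab => ->; rewrite (rep_irr rep).
have [p [ap bp]] := (rep_adj rep aU bU ne).1 ab.
apply: (gwalk_trans (q := p)).
  apply: gwalk_sub (rep_conn rep aU Dx ap) => z Dz.
  by apply/existsP; exists a; rewrite mem_head.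
have sU' : {subset s <= U} by move=> z zs; apply: sU; rewrite inE zs orbT.
apply: gwalk_sub (IH b p bU sU' bs bp Dy) => z /existsP[v /andP[vs Dz]].
by apply/existsP; exists v; rewrite inE vs orbT.
Qed.

Definition rooted_paths (r : V) (P : V -> seq V) :=
  forall a, a \in U -> path (restr G U) a (P a) /\ last a (P a) = r.

Lemma blocked_near (A : {set V}) y v p : A \subset U -> y \in A -> v \in U ->
  D y p -> D v p -> v \in closed_nbhd G A.
Proof.
move=> AU yA vU Dy Dv; rewrite inE; apply/existsP; exists y; rewrite yA /=.
case: eqVneq => //= ne.
by apply/(rep_adj rep) => //; [apply: (subsetP AU) | exists p].
Qed.

(** From [x] go left until column 0 or a string [a] is met. In the second case follow the strings of
    [P a] to the root and leave along a string-free half-line to column 0. Only strings near [P a]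
    can block this, apart from none at all on the free parts. *)
Lemma walks_to_origin : U != set0 -> exists2 r, r \in U & forall P, rooted_paths r P ->
  forall x, exists sa : seq pt * V, [/\ sa.2 \in U, path gadj x sa.1, last x sa.1 = (0, 0) &
    forall v p, v \in U -> p \in x :: sa.1 -> D v p ->
      v \in closed_nbhd G [set y in sa.2 :: P sa.2]].
Proof.
case/set0Pn => v0 v0U; have [[i1 j0] D0] := rep_ne rep v0U.
pose cov i := [exists v in U, D v (i, j0)].
have ex : exists i, cov i by exists i1; apply/existsP; exists v0; rewrite v0U.
(* No string crosses the half-line to the left of (i0, j0), a point of the root string. *)
case: (ex_minnP ex) => i0 /existsP[r /andP[rU Dr]] imin; exists r => // P rP.
have free0 v p : v \in U -> p.1 = 0 -> D v p -> false.
  by move=> vU p0 /(rep_box rep vU); rewrite p0.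
case=> i j; elim: i => [|i IH].
  (* No string meets column 0, so any vertex would do as [a]. *)
  exists (downs 0 j, r) => /=; split=> //; [exact: path_downs | exact: last_downs |].
  move=> v p vU pin Dv; suff p0 : p.1 = 0 by have := free0 v p vU p0 Dv.
  by move: pin; rewrite inE => /orP[/eqP->|/mem_downs[-> _]].
case: (boolP [exists a in U, D a (i.+1, j)]) => [/existsP[a /andP[aU Da]]|]; last first.
  rewrite negb_exists => /forallP nocov; have [[s a] /= [aU ps ls blk]] := IH.
  exists ((i, j) :: s, a) => /=; split=> //; first by rewrite ps /gadj /= !eqxx !orbT.
  move=> v p vU; rewrite inE => /orP[/eqP->|pin] Dv; last exact: blk Dv.
  by have := nocov v; rewrite vU Dv.
have [/path_restr[pa PaU] la] := rP a aU.
have Dl : D (last a (P a)) (i0, j0) by rewrite la.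
have [s [ps ls ss]] := string_walk aU PaU pa Da Dl.
exists (s ++ lefts i0 j0 ++ downs 0 j0, a) => /=; split=> //.
- by rewrite !cat_path ps ls path_lefts last_lefts path_downs.
- by rewrite !last_cat ls last_lefts last_downs.
move=> v p vU; rewrite -cat_cons mem_cat mem_cat => /or3P[pin|/mem_lefts[p2 p1]|/mem_downs[p1 _]] Dv.
- have /existsP[y /andP[yin Dy]] := allP ss p pin.
  apply: (blocked_near _ _ vU Dy Dv); last by rewrite inE.
  by apply/subsetP=> z; rewrite !inE => /orP[/eqP->//|/PaU].
- suff : i0 <= p.1 by rewrite leqNgt p1.
  by apply: imin; apply/existsP; exists v; rewrite vU /= -p2 -surjective_pairing.
- by have := free0 v p vU p1 Dv.
Qed.

(** Four is the number of corners of a unit square: if one large connected set avoids the walks from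
    all four, the parities of the four sides can be read off at a single point [q]. *)
Lemma four_path_separator : U != set0 -> exists2 r, r \in U & forall P, rooted_paths r P ->
  exists A : seq V, [/\ size A = 4, {subset A <= U} &
    forall C : {set V}, C \subset U -> conn G C ->
      [disjoint C & closed_nbhd G [set y | has (fun a => y \in a :: P a) A]] -> 2 * #|C| <= #|U|].
Proof.
move=> U0; have [r rU wk] := walks_to_origin U0; exists r => // P rP.
have {wk} [f fP] := choice (wk P rP).
apply: contrapT => no.
have bad A : size A = 4 -> {subset A <= U} -> exists C : {set V},
    [/\ C \subset U, conn G C, #|U| < 2 * #|C| &
        forall a, a \in A -> [disjoint C & closed_nbhd G [set y in a :: P a]]].
  move=> A4 AU; apply: contrapT => noC; apply: no; exists A; split=> // C CU cC dC.
  rewrite leqNgt; apply/negP => big; apply: noC; exists C; split=> // a aA.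
  apply: disjointWr dC; apply/subsetP => v; rewrite !inE => /existsP[b /andP[bin bv]].
  apply/existsP; exists b; rewrite bv andbT inE; apply/hasP; exists a => //.
  by move: bin; rewrite inE.
(* Boundary points use walks on the boundary, which meet no string and have explicit crossings. *)
pose wlk x := if rim m x then rim_walk m x else (f x).1.
pose inbox (x : pt) := (x.1 <= m) && (x.2 <= m).
have path_wlk x : path gadj x (wlk x).
  by rewrite /wlk; case: ifP => _; [exact: path_rim_walk | case: (fP x)].
have last_wlk x : last x (wlk x) = (0, 0).
  by rewrite /wlk; case: ifP => _; [exact: last_rim_walk | case: (fP x)].
have blk x v p : inbox x -> v \in U -> p \in x :: wlk x -> D v p ->
    v \in closed_nbhd G [set y in (f x).2 :: P (f x).2].
  move=> /andP[x1 x2] vU; rewrite /wlk; case: ifP => [rx pin Dv|_ pin]; last first.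
    by case: (fP x) => _ _ _; apply.
  by have := rep_box rep vU Dv; have := mem_rim_walk rx x1 x2 pin; rewrite /rim; lia.
have fU x : (f x).2 \in U by case: (fP x).
(* The winding parity around [q] of the closed walk through [x], [y] and the origin. *)
pose W q x y := crw q x (wlk x) (+) cr q x y (+) crw q y (wlk y).
pose good x y (C : {set V}) := [/\ C \subset U, conn G C, #|U| < 2 * #|C|,
  [disjoint C & closed_nbhd G [set z in (f x).2 :: P (f x).2]] &
  [disjoint C & closed_nbhd G [set z in (f y).2 :: P (f y).2]]].
have avoid x y C c q : inbox x -> inbox y -> good x y C -> c \in C -> D c q ->
    (q \notin x :: wlk x) && (q \notin y :: wlk y).
  move=> xb yb [CU _ _ dx dy] cC Dq; have cU := subsetP CU c cC.
  apply/andP; split; apply/negP => qin.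
    by move: (disjointFr dx cC); rewrite (blk x c q).
  by move: (disjointFr dy cC); rewrite (blk y c q).
(* The three parts of the closed walk have ends [x], [y] and the origin, each occurring twice, so
   the [zeta] terms cancel. *)
have Wstep x y q q' : gadj x y -> gadj q q' ->
    (q \notin x :: wlk x) && (q \notin y :: wlk y) ->
    (q' \notin x :: wlk x) && (q' \notin y :: wlk y) -> W q x y = W q' x y.
  move=> xy qq' /andP[qx qy] /andP[q'x q'y].
  have e1 := crw_move qq' (path_wlk x) qx q'x.
  have e2 := crw_move qq' (path_wlk y) qy q'y.
  have e3 : cr q x y (+) cr q' x y = zeta q q' x (+) zeta q q' y.
    apply: cr_move => //; rewrite eq_sym.
    - by apply: contraNneq qx => ->; rewrite mem_head.
    - by apply: contraNneq qy => ->; rewrite mem_head.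
    - by apply: contraNneq q'x => ->; rewrite mem_head.
    - by apply: contraNneq q'y => ->; rewrite mem_head.
  have flip (a b c : bool) : a (+) b = c -> a = c (+) b by move<-; rewrite -addbA addbb addbF.
  rewrite /W (flip _ _ _ e1) (flip _ _ _ e2) (flip _ _ _ e3) !last_wlk.
  case: (crw _ _ _); case: (crw _ _ _); case: (cr _ _ _);
  case: (zeta _ _ x); case: (zeta _ _ y); by case: (zeta _ _ _).
have Wstring x y C c q q' : inbox x -> inbox y -> gadj x y -> good x y C -> c \in C ->
    D c q -> D c q' -> W q x y = W q' x y.
  move=> xb yb xy gC cC Dq Dq'.
  have cU : c \in U by case: gC => /subsetP CU *; apply: CU.
  have [s [ps <-]] := rep_conn rep cU Dq Dq'.
  elim: s q ps {Dq} => //= z s IH q /andP[qz zs] /and3P[Dq Dz Ds].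
  rewrite -IH //= ?Dz // (Wstep x y q z) //.
    exact: (avoid x y C c q).
  exact: (avoid x y C c z).
have Wconst x y C c c' q q' : inbox x -> inbox y -> gadj x y -> good x y C ->
    c \in C -> c' \in C -> D c q -> D c' q' -> W q x y = W q' x y.
  move=> xb yb xy gC cC c'C Dq Dq'.
  have /connectP[s ps lst] : connect (restr G C) c c' by case: gC => _ cn *; apply: cn.
  elim: s c q cC ps lst Dq => [|d s IH] c q cC /= => [_ e|/andP[/and3P[_ dC cd] ps] lst] Dq.
    by subst c'; apply: (Wstring x y C c).
  have CU : C \subset U by case: gC.
  have ne : c != d by apply: contraTneq cd => ->; rewrite (rep_irr rep).
  have [p [cp dp]] := (rep_adj rep (subsetP CU _ cC) (subsetP CU _ dC) ne).1 cd.
  by rewrite (Wstring x y C c q p) // (IH d p).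
have meets x y x' y' C C' : good x y C -> good x' y' C' -> exists2 c, c \in C & c \in C'.
  move=> [CU _ bC _ _] [C'U _ bC' _ _].
  have : 0 < #|C :&: C'|.
    have := cardsUI C C'; have : #|C :|: C'| <= #|U| by apply: subset_leq_card; rewrite subUset CU.
    by lia.
  by rewrite card_gt0 => /set0Pn[c]; rewrite inE => /andP[]; exists c.
(* Two sets of more than half of the vertices meet, so this does not depend on C. *)
pose sg x y := `[< exists C c q, [/\ good x y C, c \in C, D c q & W q x y] >].
have sgE x y C c q : inbox x -> inbox y -> gadj x y -> good x y C -> c \in C -> D c q ->
    sg x y = W q x y.
  move=> xb yb xy gC cC Dq; apply/asboolP/idP => [[C' [c' [q' [gC' c'C' Dq' Wq']]]]|Wq]; last first.
    by exists C, c, q.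
  have [d dC dC'] := meets _ _ _ _ _ _ gC gC'.
  have [p Dp] : exists p, D d p by apply: (rep_ne rep); case: gC => /subsetP CU *; apply: CU.
  by rewrite (Wconst x y C c d q p) // (Wconst x y C' d c' p q').
have point x y C : good x y C -> exists cq : V * pt, cq.1 \in C /\ D cq.1 cq.2.
  move=> gC; have [c cC _] := meets _ _ _ _ _ _ gC gC.
  have [q Dq] : exists q, D c q by apply: (rep_ne rep); case: gC => /subsetP CU *; apply: CU.
  by exists (c, q).
have squareC i j : exists C, forall x y, x \in [:: (i,j); (i.+1,j); (i,j.+1); (i.+1,j.+1)] ->
    y \in [:: (i,j); (i.+1,j); (i,j.+1); (i.+1,j.+1)] -> good x y C.
  set sq := [:: _; _; _; _].
  have [||C [CU cC bC dC]] := bad [seq (f x).2 | x <- sq] => //.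
    by move=> v /mapP[x _ ->].
  exists C => x y xs ys; split=> //; apply: dC; exact: (map_f (fun x => (f x).2)).
(* A single edge has two ends only; a repetition fills the list up to four. *)
have edge x y : inbox x -> inbox y -> gadj x y -> exists q, [/\ 0 < q.1 < m, 0 < q.2 < m & sg x y = W q x y].
  move=> xb yb xy; have [||C [CU cC bC dC]] := bad [:: (f x).2; (f y).2; (f y).2; (f y).2] => //.
    by move=> v; rewrite !inE => /or4P[] /eqP->.
  have gC : good x y C by split=> //; apply: dC; rewrite !inE eqxx ?orbT.
  have [[c q] /= [cin Dq]] := point _ _ _ gC.
  exists q; rewrite (sgE x y C c q) //.
  by have := rep_box rep (subsetP CU c cin) Dq => /andP[].
have rimW x y q : rim m x -> rim m y -> 0 < q.1 < m ->
    W q x y = rim_cr q m x (+) cr q x y (+) rim_cr q m y.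
  by move=> rx ry /andP[_ qm]; rewrite /W /wlk rx ry !crw_rim_walk.
have m0 : 0 < m.
  case/set0Pn: U0 => v vU; have [p Dp] := rep_ne rep vU.
  by have := rep_box rep vU Dp; lia.
have adjH k l : gadj (k, l) (k.+1, l) by rewrite /gadj /= !eqxx !orbT.
have adjV k l : gadj (k, l) (k, l.+1) by rewrite /gadj /= !eqxx !orbT.
have hv i j : i < m -> j < m -> sg (i, j) (i.+1, j) (+) sg (i.+1, j) (i.+1, j.+1) (+)
    sg (i, j.+1) (i.+1, j.+1) (+) sg (i, j) (i, j.+1) = false.
  move=> im jm; have [C gC] := squareC i j.
  have [] := point (i, j) (i, j) C; first by apply: gC; rewrite mem_head.
  move=> [c q] /= [cC Dq].
  have box00 : inbox (i, j) by rewrite /inbox /=; lia.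
  have box10 : inbox (i.+1, j) by rewrite /inbox /=; lia.
  have box01 : inbox (i, j.+1) by rewrite /inbox /=; lia.
  have box11 : inbox (i.+1, j.+1) by rewrite /inbox /=; lia.
  have g x y : x \in [:: (i,j); (i.+1,j); (i,j.+1); (i.+1,j.+1)] ->
    y \in [:: (i,j); (i.+1,j); (i,j.+1); (i.+1,j.+1)] -> inbox x -> inbox y -> gadj x y -> sg x y = W q x y.
    by move=> xs ys xb yb xy; apply: (sgE x y C c q) => //; apply: gC.
  rewrite !g ?inE ?eqxx ?orbT //.
  (* Each of the four walks occurs twice and cancels. What remains is the boundary of the unit
     square: its two vertical sides are both crossed or both not, unless [q] is the lower left
     corner. *)
  have : q != (i, j).
    have g00 : good (i, j) (i, j) C by apply: gC; rewrite mem_head.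
    have /andP[+ _] := avoid (i, j) (i, j) C c q box00 box00 g00 cC Dq.
    by apply: contraNneq => ->; rewrite mem_head.
  case: q {Dq g} => a b; rewrite xpair_eqE => ne.
  have : cr (a, b) (i.+1, j) (i.+1, j.+1) (+) cr (a, b) (i, j) (i, j.+1) = false.
    by move: ne; rewrite /cr /=; lia.
  have ch k : cr (a, b) (i, k) (i.+1, k) = false by rewrite /cr /= addbb andbF.
  rewrite /W !ch; case: (cr _ _ _); case: (cr _ _ _) => //= _;
  case: (crw _ _ (wlk (i, j))); case: (crw _ _ (wlk (i.+1, j)));
  case: (crw _ _ (wlk (i, j.+1))); by case: (crw _ _ (wlk (i.+1, j.+1))).
have := @stokes m (fun i j => sg (i, j) (i.+1, j)) (fun i j => sg (i, j) (i, j.+1)) hv.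
rewrite /= 3?big1 /= => [|i _|i _|i _]; first last.
- have im := ltn_ord i.
  have xb : inbox (i : nat, 0) by rewrite /inbox /= leq0n ltnW.
  have yb : inbox (i.+1, 0) by rewrite /inbox /= leq0n im.
  have [q [q1 q2 ->]] := edge _ _ xb yb (adjH _ _).
  by rewrite rimW /rim /= ?orbT // /rim_cr /cr /= ?ltn0 ?andbF ?addbb ?andbF.
- have im := ltn_ord i.
  have xb : inbox (i : nat, m) by rewrite /inbox /= leqnn ltnW.
  have yb : inbox (i.+1, m) by rewrite /inbox /= leqnn im.
  have [q [q1 q2 ->]] := edge _ _ xb yb (adjH _ _).
  by rewrite rimW /rim /= ?eqxx ?orbT // /rim_cr /cr /= ltnn /= ?andbF ?addbb ?andbF.
- have im := ltn_ord i.
  have xb : inbox (0, i : nat) by rewrite /inbox /= ltnW.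
  have yb : inbox (0, i.+1) by rewrite /inbox /=.
  have [q [q1 q2 ->]] := edge _ _ xb yb (adjV _ _).
  by rewrite rimW /rim /= ?eqxx // /rim_cr /cr /= (ltn_eqF m0).
(* All values on the other three sides are 0. On the right side the slit leaves 1 on the top edge
   alone, so the total is odd, against [stokes]. *)
rewrite (eq_bigr (fun i : 'I_m => (i : nat) == m.-1)); last first.
  move=> i _; have im := ltn_ord i.
  have xb : inbox (m, i : nat) by rewrite /inbox /= leqnn ltnW.
  have yb : inbox (m, i.+1) by rewrite /inbox /= leqnn im.
  have [q [/andP[q0 q1] /andP[_ q2] ->]] := edge _ _ xb yb (adjV _ _).
  rewrite rimW /rim /= ?eqxx ?orbT ?q0 // /rim_cr /cr /= eqxx im q1 /=.
  rewrite addbA addbb addFb; case: (ltnP i.+1 m) => h.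
    by rewrite addbb; apply/esym/ltn_eqF; rewrite -ltnS prednK.
  have -> : (i : nat) = m.-1 by apply/eqP; rewrite eqn_leq -ltnS prednK // im -ltnS prednK.
  by rewrite prednK // q2 eqxx.
rewrite -(prednK m0) big_ord_recr /= eqxx big1 // => i _.
by apply/ltn_eqF.
Qed.
End Separator.

(** * Connectivity and shortest paths *)

Definition stringlike (V : finType) (U : {set V}) (G : rel V) : Prop :=
  exists m D, grid_rep U G m D.

Lemma stringlike_sub (V : finType) (U W : {set V}) (G : rel V) :
  W \subset U -> stringlike U G -> stringlike W G.
Proof.
move=> /subsetP WU [m [D [sy ir bx ne cn ad]]]; exists m, D; split=> //.
- by move=> v p /WU; apply: bx.
- by move=> v /WU; apply: ne.
- by move=> v p q /WU; apply: cn.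
- by move=> u v /WU uU /WU; apply: ad.
Qed.

Lemma stringlike_sym (V : finType) (U : {set V}) (G : rel V) : stringlike U G -> symmetric G.
Proof. by case=> m [D []]. Qed.

Lemma stringlike_irr (V : finType) (U : {set V}) (G : rel V) : stringlike U G -> irreflexive G.
Proof. by case=> m [D []]. Qed.

Section Connectivity.
Variables (V : finType) (G : rel V).
Hypothesis Gsym : symmetric G.

Lemma restr_sym (A : {set V}) : symmetric (restr G A).
Proof. by move=> x y; rewrite /restr /= andbCA Gsym. Qed.

Lemma restr_csym (A : {set V}) : connect_sym (restr G A).
Proof. exact/sym_connect_sym/restr_sym. Qed.

Definition comp (U : {set V}) x : {set V} := [set y | connect (restr G U) x y].

Lemma comp_sub (U : {set V}) x : x \in U -> comp U x \subset U.
Proof.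
move=> xU; apply/subsetP=> y; rewrite inE => /connectP[s].
elim/last_ind: s => [_ ->//|s z _]; rewrite rcons_path last_rcons => /andP[_] + ->.
by case/and3P.
Qed.

Lemma conn_comp (U : {set V}) x : x \in U -> conn G (comp U x).
Proof.
move=> xU; suff h y : y \in comp U x -> connect (restr G (comp U x)) x y.
  by move=> y z /h hy /h hz; apply: connect_trans hz; rewrite restr_csym.
rewrite inE => /connectP[s].
elim/last_ind: s y => [y _ ->//|s z IH y]; rewrite rcons_path last_rcons => /andP[ps lz] ->.
apply: (connect_trans (IH _ ps erefl)); apply: connect1; case/and3P: (lz) => _ zU e.
have h : connect (restr G U) x (last x s) by apply/connectP; exists s.
by rewrite /restr /= e !inE h (connect_trans h (connect1 lz)).
Qed.

Lemma comp_cut (U : {set V}) x y z : y \in comp U x -> z \in U :\: comp U x -> x \in U -> ~~ G y z.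
Proof.
move=> yc; rewrite inE => /andP[zc zU] xU; apply: contra zc => yz.
have yU := subsetP (comp_sub xU) y yc.
rewrite inE; move: yc; rewrite inE => /connect_trans; apply.
by apply: connect1; rewrite /restr /= yU zU.
Qed.

Lemma conn_cut (K W C : {set V}) : conn G C -> C \subset K :|: W ->
  (forall x y, x \in K -> y \in W -> ~~ G x y) -> C \subset K \/ C \subset W.
Proof.
move=> cC CKW cut; case: (set_0Vmem (C :&: K)) => [CK0|[x]].
  right; apply/subsetP=> y yC; move/subsetP/(_ y yC): CKW; rewrite inE => /orP[yK|//].
  by move/setP/(_ y): CK0; rewrite !inE yC yK.
rewrite inE => /andP[xC xK]; left; apply/subsetP=> y yC.
have /connectP[s] := cC x y xC yC; elim: s x xK {xC} => /= [x xK _ ->//|z s IH x xK].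
move=> /andP[/and3P[_ zC xz] zs] ly; apply: (IH z) => //.
move/subsetP/(_ z zC): CKW; rewrite inE => /orP[//|zW].
by rewrite (negPf (cut _ _ xK zW)) in xz.
Qed.

(** Splits off one component at a time, which reduces claims about arbitrary sets to connected
    ones. *)
Lemma comp_ind (P : {set V} -> Prop) : P set0 ->
  (forall K, K != set0 -> conn G K -> P K) ->
  (forall K W : {set V}, [disjoint K & W] -> (forall x y, x \in K -> y \in W -> ~~ G x y) ->
     P K -> P W -> P (K :|: W)) ->
  forall U, P U.
Proof.
move=> P0 Pc Pu U; move: {2}#|U| (leqnn #|U|) => n; elim: n U => [|n IH] U.
  by rewrite leqn0 cards_eq0 => /eqP->.
move=> Un; case: (set_0Vmem U) => [->//|[x xU]].
have xc : x \in comp U x by rewrite inE connect0.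
have cU := comp_sub xU.
have e : comp U x :|: U :\: comp U x = U by rewrite -{1}(setIidPr cU) setID.
rewrite -e; apply: Pu.
- by rewrite -setI_eq0 setIDA setIC -setIDA setDv setI0.
- by move=> y z yc zc; apply: comp_cut zc xU.
- by apply: Pc; [apply/set0Pn; exists x | apply: conn_comp].
apply: IH; rewrite -ltnS; apply: leq_trans Un; apply: proper_card; apply/properP; split.
  exact: subsetDl.
by exists x => //; rewrite inE xc.
Qed.

(** [d] is the distance to [r] within [K], and [P a] is a shortest path. Along it [d] strictly
    decreases, so it has at most one vertex in each layer. *)
Lemma bfs (K : {set V}) r : conn G K -> r \in K -> exists (d : V -> nat) (P : V -> seq V),
  [/\ forall x y, x \in K -> y \in K -> G x y -> d x <= (d y).+1,
      rooted_paths K G r P &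
      forall a, a \in K -> {in a :: P a &, injective d}].
Proof.
move=> cK rK.
have /choice[d dP] : forall x, exists n, x \in K ->
    (exists s, [/\ path (restr G K) x s, last x s = r & size s = n]) /\
    forall s, path (restr G K) x s -> last x s = r -> n <= size s.
  move=> x; case: (boolP (x \in K)) => [xK|_]; last by exists 0.
  pose p n := [exists s : n.-tuple V, path (restr G K) x s && (last x s == r)].
  have ex : exists n, p n.
    have /connectP[s ps ls] := cK x r xK rK.
    by exists (size s); apply/existsP; exists (in_tuple s) => /=; rewrite ps -ls eqxx.
  case: (ex_minnP ex) => n /existsP[s /andP[ps /eqP ls]] nmin; exists n => _; split.
    by exists s; rewrite size_tuple.
  move=> s' ps' ls'; apply: nmin; apply/existsP; exists (in_tuple s').
  by rewrite /= ps' ls' eqxx.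
have /choice[P PP] : forall a, exists s, a \in K ->
    [/\ path (restr G K) a s, path (fun x y => d y < d x) a s & last a s = r].
  move=> a; move: {2}(d a) (leqnn (d a)) => n; elim: n a => [|n IH] a dan.
    exists [::] => aK; split=> //; have [[s [_ <- sz]] _] := dP a aK.
    by case: s sz dan => //= b s <-.
  case: (boolP (a \in K)) => [aK|_]; last by exists [::].
  have [[[|b s] [ps ls sz]] _] := dP a aK; first by exists [::].
  move: ps ls sz => /= /andP[ab ps] ls sz; case/and3P: (ab) => _ bK _.
  have db : d b <= size s by have [_] := dP b bK; apply.
  have [|s' s'P] := IH b; first by move: dan; rewrite -sz ltnS; apply: leq_trans.
  by exists (b :: s') => _ /=; have [-> -> ->] := s'P bK; rewrite ab -sz ltnS db.
exists d, P; split.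
- move=> x y xK yK xy; have [[s [ps ls <-]] _] := dP y yK; have [_ h] := dP x xK.
  by apply: (h (y :: s)) => //=; rewrite ps /restr /= xK yK xy.
- by move=> a aK; have [? _ ?] := PP a aK.
move=> a /PP[_ + _]; move: (P a) => s; elim: s a => [|b s IH] a.
  by move=> _ x y; rewrite !inE => /eqP-> /eqP->.
move=> dec; have lt x : x \in b :: s -> d x < d a.
  move: x; apply/allP; apply: order_path_min dec => u v w h1 h2; exact: ltn_trans h2 h1.
move: dec => /= /andP[_ /IH inj] x y; rewrite inE => /orP[/eqP->|xs]; rewrite inE => /orP[/eqP->|ys] //.
- by move=> e; have := lt y ys; rewrite -e ltnn.
- by move=> e; have := lt x xs; rewrite e ltnn.
- exact: inj.
Qed.

End Connectivity.

(** * Paths of bounded length and edge counts *)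

Section Hops.
Variable V : finType.
Implicit Types E : {set V * V}.

(** Edge sets consist of ordered pairs, so that out-degrees bound their size; here the directions
    are forgotten. *)
Definition symE E : rel V := [rel x y | ((x, y) \in E) || ((y, x) \in E)].

Definition hop E t u v := exists p, [/\ path (symE E) u p, last u p = v & size p <= t].

Lemma hop0 E u : hop E 0 u u. Proof. by exists [::]. Qed.

Lemma hop1 E u v : (u, v) \in E -> hop E 1 u v.
Proof. by move=> uv; exists [:: v]; rewrite /= /symE /= uv. Qed.

Lemma hop_trans E s t u v w : hop E s u v -> hop E t v w -> hop E (s + t) u w.
Proof.
move=> [p [pp lp sp]] [q [pq lq sq]]; exists (p ++ q); split.
- by rewrite cat_path pp lp.
- by rewrite last_cat lp.
- by rewrite size_cat leq_add.
Qed.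

Lemma hop_sym E t u v : hop E t u v -> hop E t v u.
Proof.
move=> [p [pp <- sp]]; exists (rev (belast u p)); split.
- rewrite rev_path; apply: sub_path pp => x y; by rewrite /symE /= orbC.
- by case: p {pp sp} => //= a p; rewrite rev_cons last_rcons.
- by rewrite size_rev size_belast.
Qed.

Lemma hop_sub E E' t t' u v : E \subset E' -> t <= t' -> hop E t u v -> hop E' t' u v.
Proof.
move=> /subsetP EE' tt' [p [pp lp sp]]; exists p; split=> //; last exact: leq_trans tt'.
by apply: sub_path pp => x y /orP[] /EE' h; rewrite /symE /= h ?orbT.
Qed.

Lemma card_out_edges (U : {set V}) E c :
  (forall u v, (u, v) \in E -> u \in U) ->
  (forall u, u \in U -> #|[set v | (u, v) \in E]| <= c) -> #|E| <= c * #|U|.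
Proof.
move=> EU Ec.
have -> : #|E| = \sum_(u in U) #|[set v | (u, v) \in E]|.
  rewrite -sum1_card (partition_big (fun e => e.1) (mem U)) /=; last first.
    by case=> u v /EU.
  apply: eq_bigr => u uU; rewrite -sum1_card.
  rewrite (reindex_onto (fun v => (u, v)) (fun e => e.2)) /=; last first.
    by case=> a b /andP[_ /eqP/= ->].
  by apply: eq_bigl => v; rewrite !inE !eqxx !andbT.
by rewrite mulnC -sum_nat_const; apply: leq_sum.
Qed.

Lemma card_window (d : V -> nat) (A : {set V}) lo w : {in A &, injective d} ->
  (forall p, p \in A -> lo <= d p < lo + w) -> #|A| <= w.
Proof.
move=> dinj dw; rewrite cardE -(size_map d) -(size_iota lo w); apply: uniq_leq_size.
  rewrite map_inj_in_uniq ?enum_uniq // => x y; rewrite !mem_enum; exact: dinj.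
by move=> n /mapP[p]; rewrite mem_enum => /dw pw ->; rewrite mem_iota.
Qed.

End Hops.

(** * Three-hop spanners *)

Section Spanners.
Variables (V : finType) (G : rel V).
Implicit Types (U K W C S : {set V}) (E : {set V * V}).

(** Bounds the component sizes without naming components, and so passes directly to subsets. *)
Definition small U m := forall C, C \subset U -> conn G C -> #|C| <= m.

Definition edges_in E := forall u v, (u, v) \in E -> G u v.

Definition covers E t U W := forall u v, u \in W -> v \in U -> G u v -> hop E t u v.

Definition spans U t b := exists E, [/\ edges_in E, #|E| <= b & covers E t U U].

(** [W] is what remains to be done: for symmetric [G], the only edges of [U] not yet covered have
    both ends in [W]. *)
Definition peels U W t b :=
  W \subset U /\ exists E, [/\ edges_in E, #|E| <= b & covers E t U (U :\: W)].

Lemma small_le U m m' : m <= m' -> small U m -> small U m'.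
Proof. by move=> mm' sU C CU cC; apply: leq_trans mm'; apply: sU. Qed.

Lemma edges_inU E E' : edges_in E -> edges_in E' -> edges_in (E :|: E').
Proof. by move=> hE hE' u v; rewrite inE => /orP[/hE|/hE']. Qed.

Lemma peels_spans U W t b b' : symmetric G ->
  peels U W t b -> spans W t b' -> spans U t (b + b').
Proof.
move=> Gsym [WU [E [inE1 cE cov]]] [E' [inE2 cE' cov']]; exists (E :|: E'); split.
- exact: edges_inU.
- by apply: leq_trans (leq_card_setU _ _) _; apply: leq_add.
move=> u v uU vU uv; case: (boolP (u \in W)) => uW; last first.
  by apply: (hop_sub (subsetUl _ _) (leqnn _)); apply: cov => //; rewrite inE uW.
case: (boolP (v \in W)) => vW.
  by apply: (hop_sub (subsetUr _ _) (leqnn _)); apply: cov'.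
apply: hop_sym; apply: (hop_sub (subsetUl _ _) (leqnn _)); apply: cov => //.
  by rewrite inE vW.
by rewrite Gsym.
Qed.

Lemma peels_trans U U' W t b b' : symmetric G ->
  peels U U' t b -> peels U' W t b' -> peels U W t (b + b').
Proof.
move=> Gsym [U'U [E [inE1 cE cov]]] [WU' [E' [inE2 cE' cov']]]; split.
  exact: subset_trans WU' U'U.
exists (E :|: E'); split.
- exact: edges_inU.
- by apply: leq_trans (leq_card_setU _ _) _; apply: leq_add.
move=> u v; rewrite inE => /andP[uW uU] vU uv; case: (boolP (u \in U')) => uU'; last first.
  by apply: (hop_sub (subsetUl _ _) (leqnn _)); apply: cov => //; rewrite inE uU'.
case: (boolP (v \in U')) => vU'.
  by apply: (hop_sub (subsetUr _ _) (leqnn _)); apply: cov' => //; rewrite inE uW.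
apply: hop_sym; apply: (hop_sub (subsetUl _ _) (leqnn _)); apply: cov => //.
  by rewrite inE vU'.
by rewrite Gsym.
Qed.

(** The separator is applied to shortest paths: each of the four has at most [w] vertices in [w]
    consecutive layers. *)
Lemma bfs_separator K : stringlike K G -> conn G K -> K != set0 ->
  exists (d : V -> nat) (P : {set V}), [/\ P \subset K,
    forall x y, x \in K -> y \in K -> G x y -> d x <= (d y).+1,
    forall lo w, #|[set p in P | lo <= d p < lo + w]| <= 4 * w &
    forall C, C \subset K -> conn G C -> [disjoint C & closed_nbhd G P] -> 2 * #|C| <= #|K|].
Proof.
move=> sK cK K0; have Gsym := stringlike_sym sK; case: sK => m [D rep].
have [r rK sep] := four_path_separator rep K0.
have [d [Q [lip rQ inj]]] := bfs cK rK.
have [A [A4 AK sepA]] := sep Q rQ.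
exists d, [set y | has (fun a => y \in a :: Q a) A]; split=> //.
  apply/subsetP=> y; rewrite inE => /hasP[a aA]; rewrite inE => /orP[/eqP->|yQ].
    exact: AK.
  by have [/path_restr[_ QK] _] := rQ a (AK a aA); apply: QK.
move=> lo w; rewrite -{}A4 {sepA}; elim: A AK => [|a A IH] AK.
  by rewrite (_ : [set _ in _ | _] = set0) ?cards0 //; apply/setP=> y; rewrite !inE.
have aK : a \in K by apply: AK; rewrite mem_head.
have -> : [set p in [set y | has (fun a => y \in a :: Q a) (a :: A)] | lo <= d p < lo + w] =
  [set p in a :: Q a | lo <= d p < lo + w] :|:
  [set p in [set y | has (fun a => y \in a :: Q a) A] | lo <= d p < lo + w].
  by apply/setP=> y; rewrite !inE /= inE andb_orl.
apply: leq_trans (leq_card_setU _ _) _; rewrite mulSn leq_add //.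
  apply: (@card_window _ d _ lo); last by move=> p; rewrite inE => /andP[].
  by move=> x y; rewrite !inE => /andP[xa _] /andP[ya _]; apply: (inj a aK).
by apply: IH => x xA; apply: AK; rewrite inE xA orbT.
Qed.

Lemma near_layers K (d : V -> nat) x y : symmetric G ->
  (forall x y, x \in K -> y \in K -> G x y -> d x <= (d y).+1) ->
  x \in K -> y \in K -> (x == y) || G x y -> (d x <= (d y).+1) /\ (d y <= (d x).+1).
Proof.
move=> Gsym lip xK yK /orP[/eqP->|xy]; first by rewrite leqnSn.
by rewrite !lip // Gsym.
Qed.

(** Five layers lie within distance 2 of [x]; truncating [x - 2] at 0 loses none of them. *)
Lemma near_window x y : x <= y.+2 -> y <= x.+2 -> x - 2 <= y < x - 2 + 5.
Proof. lia. Qed.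

(* An edge u v with u next to a path vertex p is replaced by v - w - p - u, where w is
   a neighbour of v chosen once for each pair (v, p); only five vertices p of a shortest
   path are that close to v. *)
Lemma peel_half_conn K : stringlike K G -> conn G K -> K != set0 ->
  exists W, peels K W 3 (40 * #|K|) /\
    forall C, C \subset W -> conn G C -> 2 * #|C| <= #|K|.
Proof.
move=> sK cK K0; have Gsym := stringlike_sym sK.
have [d [P [PK lip win sep]]] := bfs_separator sK cK K0.
have near := near_layers Gsym lip.
exists (K :\: closed_nbhd G P); split; last first.
  move=> C CW cC; apply: sep cC _; first exact: subset_trans CW (subsetDl _ _).
  by move: CW; rewrite subsetD => /andP[].
split; first exact: subsetDl.
pose A v := [set p in P | d v - 2 <= d p < d v - 2 + 5].
pose f v p := odflt v [pick w | [&& w \in K, G v w & (w == p) || G w p]].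
(* Four paths and five layers give at most 20 vertices [p] for each [v], and each [p] gives one
   [f v p], hence 40. The default value [v] of [f] adds no edge, as [G] is irreflexive. *)
exists [set e | [&& e.1 \in K, G e.1 e.2 & e.2 \in A e.1 :|: f e.1 @: A e.1]]; split.
- by move=> u v; rewrite inE => /and3P[].
- apply: card_out_edges => [u v|u uK]; first by rewrite inE => /and3P[].
  apply: (@leq_trans #|A u :|: f u @: A u|).
    by apply/subset_leq_card/subsetP=> v; rewrite !inE => /and3P[].
  apply: leq_trans (leq_card_setU _ _) _.
  have Au : #|A u| <= 4 * 5 by apply: win.
  by rewrite (@leq_add _ _ 20 20) //; apply: leq_trans (leq_imset_card _ _) _.
set E := [set e | _]; move=> u v uX vK uv.
have [uK uP] : u \in K /\ u \in closed_nbhd G P by move: uX; rewrite setDDr setDv set0U inE => /andP[].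
move: uP; rewrite inE => /existsP[p /andP[pP pu]].
have pK := subsetP PK p pP.
have toE x : x \in K -> G x p -> (x, p) \in E.
  move=> xK xp; rewrite inE xK xp /= inE; apply/orP; left.
  rewrite inE pP; have [|h h'] := near x p xK pK; first by rewrite xp orbT.
  by apply: near_window; apply: leqW.
have [w [wK vw wp fw]] : exists w, [/\ w \in K, G v w, (w == p) || G w p & f v p = w].
  rewrite /f; case: pickP => [w /and3P[wK vw wp]|no]; first by exists w.
  by have := no u; rewrite uK (Gsym v) uv eq_sym (Gsym u) pu.
have hvw : hop E 1 v w.
  apply: hop1; rewrite inE vK vw /= inE -fw; apply/orP; right; apply: imset_f.
  rewrite inE pP; have [|h1 h2] := near v w vK wK; first by rewrite vw orbT.
  have [h3 h4] := near w p wK pK wp.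
  by apply: near_window; [apply: leq_trans h1 _ | apply: leq_trans h4 _]; rewrite ltnS.
have hx x : x \in K -> (x == p) || G x p -> hop E 1 x p.
  move=> xK /orP[/eqP->|xp]; last exact/hop1/toE.
  exact: hop_sub (subxx _) (leqW (leqnn 0)) (hop0 _ _).
apply: (hop_trans (s := 1) (t := 2) (v := p)).
  by apply: hx => //; rewrite eq_sym Gsym.
by apply: hop_sym; apply: (hop_trans (s := 1) (t := 1) (v := w)) => //; apply: hx.
Qed.

(** The cost is linear in the number of vertices, so it adds up over the components. *)
Lemma peel_half U m : stringlike U G -> small U (2 * m) ->
  exists W, peels U W 3 (40 * #|U|) /\ small W m.
Proof.
move=> sU smU; have Gsym := stringlike_sym sU.
pose Q (X : {set V}) := X \subset U -> exists W, peels X W 3 (40 * #|X|) /\ small W m.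
apply: (comp_ind Gsym (P := Q)) => // [|K K0 cK KU|K X dis cut QK QX KXU].
- move=> _; exists set0; split.
    split; first exact: sub0set.
    exists set0; split; rewrite ?cards0 //; first by move=> u v; rewrite inE.
    by move=> u v; rewrite !inE.
  by move=> C; rewrite subset0 => /eqP->; rewrite cards0.
- have [W [pW hW]] := peel_half_conn (stringlike_sub KU sU) cK K0; exists W; split=> //.
  move=> C CW cC; have := hW C CW cC; have := smU K KU cK; lia.
have [|W1 [[W1K [E1 [in1 c1 cov1]]] s1]] := QK; first exact: subset_trans (subsetUl _ _) KXU.
have [|W2 [[W2X [E2 [in2 c2 cov2]]] s2]] := QX; first exact: subset_trans (subsetUr _ _) KXU.
exists (W1 :|: W2); split; last first.
  have cutW x y : x \in W1 -> y \in W2 -> ~~ G x y.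
    by move=> xW yW; apply: cut; [apply: (subsetP W1K)|apply: (subsetP W2X)].
  by move=> C CW cC; case: (conn_cut cC CW cutW) => h; [exact: s1|exact: s2].
split; first exact: setUSS.
exists (E1 :|: E2); split.
- exact: edges_inU.
- apply: leq_trans (leq_card_setU _ _) _.
  by rewrite cardsU (eqP (_ : K :&: X == set0)) ?setI_eq0 // cards0 subn0 mulnDr leq_add.
move=> u v; rewrite !inE negb_or => /andP[/andP[uW1 uW2] /orP[uK|uX]] /orP[vK|vX] uv.
- by apply: (hop_sub (subsetUl _ _) (leqnn _)); apply: cov1 => //; rewrite inE uW1.
- by rewrite (negPf (cut _ _ uK vX)) in uv.
- by rewrite Gsym (negPf (cut _ _ vK uX)) in uv.
- by apply: (hop_sub (subsetUr _ _) (leqnn _)); apply: cov2 => //; rewrite inE uW2.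
Qed.

(** After [l] halvings the components are single vertices, and no edge remains. *)
Lemma spans_logarithm U l : stringlike U G -> small U (2 ^ l) -> spans U 3 (40 * #|U| * l).
Proof.
elim: l U => [|l IH] U sU smU.
  exists set0; split; rewrite ?cards0 //; first by move=> u v; rewrite inE.
  move=> u v uU vU uv; suff : #|[set u; v]| <= 1.
    by rewrite cards2; case: eqVneq uv => // ->; rewrite (stringlike_irr sU).
  apply: smU; first by rewrite subUset !sub1set uU.
  have Gsym := stringlike_sym sU.
  have c : connect (restr G [set u; v]) u v by apply: connect1; rewrite /restr /= !inE !eqxx orbT.
  move=> x y; rewrite !inE => /orP[] /eqP-> /orP[] /eqP-> //.
  by rewrite restr_csym.
have [|W [pW sW]] := @peel_half U (2 ^ l) sU; first by rewrite -expnS.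
have WU : W \subset U by case: pW.
have [E [inE cE cov]] := IH W (stringlike_sub WU sU) sW.
rewrite mulnS; apply: peels_spans pW _; first exact: stringlike_sym sU.
exists E; split=> //; apply: leq_trans cE _.
by rewrite leq_mul2r leq_mul2l /= (subset_leq_card WU) orbT.
Qed.

End Spanners.

(** * Divisions by stars *)

Lemma leq_expl a b n : a <= b -> a ^ n <= b ^ n.
Proof. by case: n => // n ab; rewrite leq_exp2r. Qed.

Section Division.
Variables (V : finType) (G : rel V).
Implicit Types (U K W C S : {set V}) (E : {set V * V}).

(** Pigeonhole: the [s] layers are disjoint parts of [K], so one has at most the average size. *)
Lemma sparse_layer (e : V -> nat) K lo s : 0 < s ->
  exists2 i, i < s & s * #|[set v in K | e v == lo + i]| <= #|K|.
Proof.
move=> s0; apply: contrapT => no.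
have big i : i < s -> #|K| < s * #|[set v in K | e v == lo + i]|.
  by move=> lis; rewrite ltnNge; apply/negP => h; apply: no; exists i.
have win k : k <= s -> k * #|K|.+1 <= s * #|[set v in K | lo <= e v < lo + k]|.
  elim: k => // k IH ks; rewrite mulSn addnC.
  apply: (@leq_trans (s * (#|[set v in K | lo <= e v < lo + k]| + #|[set v in K | e v == lo + k]|))).
    by rewrite mulnDr; apply: leq_add; [apply/IH/ltnW | apply: big].
  rewrite leq_mul2l -cardsUI; apply/orP; right.
  rewrite [X in _ + X](_ : _ = 0) ?addn0.
    apply/subset_leq_card/subsetP=> v; rewrite !inE -andb_orr => /andP[-> h] /=.
    by case/orP: h => [/andP[-> h]|/eqP->]; rewrite addnS ltnS ?leq_addr //= ltnW.
  apply/eqP; rewrite cards_eq0; apply/eqP/setP=> v; rewrite !inE.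
  by case: eqVneq => [->|]; rewrite ?ltnn !andbF.
have := win s (leqnn s); rewrite leq_mul2l eqn0Ngt s0 /=; apply/negP; rewrite -ltnNge ltnS.
by apply/subset_leq_card/subsetP=> v; rewrite inE => /andP[].
Qed.

(* Lipton-Tarjan: two sparse breadth-first layers around the median one cut the graph into
   a bottom, a top, and a band that four shortest paths, restricted to the band, halve. *)
Lemma star_separator K s : stringlike K G -> conn G K -> K != set0 -> 0 < s ->
  exists S x, [/\ S \subset K, s * x <= #|K|, #|S| <= 2 * x + 8 * s &
    forall C, C \subset K -> conn G C -> [disjoint C & closed_nbhd G S] -> 2 * #|C| <= #|K|].
Proof.
move=> sK cK K0 s0; have Gsym := stringlike_sym sK.
have [d [P [PK lip win sep]]] := bfs_separator sK cK K0.
have near := near_layers Gsym lip.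
(* The shift leaves room for [s] layers below the median one, even next to the root. *)
pose e v := d v + s.
pose below i := [set v in K | e v < i].
have [mu [mu1 mu2 smu]] : exists mu, [/\ 2 * #|below mu| <= #|K|, #|K| <= 2 * #|below mu.+1| & s <= mu].
  have ex : exists i, #|K| <= 2 * #|below i.+1|.
    exists (\max_v e v); rewrite (_ : below _ = K) ?leq_pmull //.
    by apply/setP=> v; rewrite inE ltnS leq_bigmax andbT.
  case: (ex_minnP ex) => mu h hmin; exists mu; split=> //.
    case: mu h hmin => [|mu] h hmin.
      by rewrite (_ : below 0 = set0) ?cards0 //; apply/setP=> v; rewrite !inE ltn0 andbF.
    by rewrite leqNgt; apply/negP => /ltnW /hmin; rewrite ltnn.
  rewrite leqNgt; apply/negP => mus; move: h.
  rewrite (_ : below _ = set0) ?cards0 ?muln0 ?leqn0 ?cards_eq0 ?(negPf K0) //.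
  apply/setP=> v; rewrite !inE; apply/negbTE; rewrite negb_and -leqNgt; apply/orP; right.
  by apply: leq_trans mus _; apply: leq_addl.
have [i lis Li] := sparse_layer e K (mu.+1 - s) s0.
have [j ljs Lj] := sparse_layer e K mu.+1 s0.
set a := mu.+1 - s + i in Li; set b := mu.+1 + j in Lj.
pose La := [set v in K | e v == a]; pose Lb := [set v in K | e v == b].
(* The layers from [a] to [b] span at most [2 * s] values of [d], so four paths give [8 * s]. The
   second [- s] undoes the shift. *)
pose band := [set p in P | mu.+1 - s - s <= d p < mu.+1 - s - s + 2 * s].
have ab : [/\ mu < a + s, a <= mu & mu < b <= mu + s] by rewrite /a /b; split; lia.
case: ab => a1 a2 /andP[b1 b2].
exists (La :|: Lb :|: band), (maxn #|La| #|Lb|); split.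
- rewrite !subUset -andbA; apply/and3P; split; apply/subsetP=> v; rewrite inE => /andP[] //.
  by move=> /(subsetP PK).
- by rewrite /maxn; case: ifP.
- apply: leq_trans (leq_card_setU _ _) _.
  have wb : #|band| <= 8 * s by rewrite (_ : 8 * s = 4 * (2 * s)) ?win // mulnA.
  rewrite leq_add // mul2n -addnn; apply: leq_trans (leq_card_setU _ _) _.
  by rewrite leq_add // ?leq_maxl ?leq_maxr.
move=> C CK cC dis.
have notS v p : v \in C -> p \in La :|: Lb :|: band -> (p == v) || G p v -> False.
  move=> vC pS pv; suff : false by []; rewrite -(disjointFr dis vC) inE.
  by apply/existsP; exists p; rewrite pS.
have offa v : v \in C -> e v != a.
  move=> vC; apply/negP => eva; have vK := subsetP CK v vC.
  by apply: (notS v v) => //; rewrite ?eqxx // !inE vK eva.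
have offb v : v \in C -> e v != b.
  move=> vC; apply/negP => eva; have vK := subsetP CK v vC.
  by apply: (notS v v) => //; rewrite ?eqxx // !inE vK eva ?orbT.
have cutat c x y : x \in C :&: below c -> y \in C :\: below c.+1 -> ~~ G x y.
  rewrite !inE => /andP[xC /andP[xK ex]] /andP[+ yC].
  have yK := subsetP CK y yC; rewrite yK /= -leqNgt => ey; apply/negP => xy.
  have [_] := near x y xK yK (introT orP (or_intror xy)).
  by move: ex ey; rewrite /e; clear; lia.
have split_at c : (forall v, v \in C -> e v != c) -> C \subset below c \/ C \subset C :\: below c.+1.
  move=> offc; have : C \subset (C :&: below c) :|: (C :\: below c.+1).
    apply/subsetP=> v vC; rewrite !inE vC (subsetP CK v vC) /= andbT.
    by rewrite -leqNgt -neq_ltn offc.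
  case/(conn_cut cC) => [x y|h|h]; first exact: cutat.
    by left; apply: subset_trans h (subsetIr _ _).
  by right.
case: (split_at a offa) => Ca.
  apply: leq_trans mu1; rewrite leq_mul2l; apply/subset_leq_card/(subset_trans Ca).
  by apply/subsetP=> v; rewrite !inE => /andP[-> ev]; apply: leq_trans ev a2.
case: (split_at b offb) => Cb; last first.
  have d0 : [disjoint C & below mu.+1].
    apply/pred0P=> v /=; apply/negbTE/negP=> /andP[vC].
    have := subsetP Cb v vC; rewrite !inE (subsetP CK v vC) vC andbT /= -leqNgt => ev.
    by rewrite ltnNge (leq_trans _ ev) // ltnW.
  have := cardsUI C (below mu.+1); rewrite (eqP (_ : C :&: _ == set0)) ?setI_eq0 // cards0.
  have : #|C :|: below mu.+1| <= #|K|.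
    by apply/subset_leq_card; rewrite subUset CK; apply/subsetP=> v; rewrite inE => /andP[].
  by move: mu2; clear; lia.
(* Now [C] lies strictly between the layers [a] and [b], so a path vertex equal or adjacent to one
   of [C] is in [band]; hence [C] avoids the neighbourhood of all of [P]. *)
apply: sep => //; apply/pred0P=> v /=; apply/negbTE/negP=> /andP[vC].
rewrite inE => /existsP[p /andP[pP pv]]; apply: (notS v p) => //.
have vK := subsetP CK v vC; have pK := subsetP PK p pP.
have [h1 h2] := near p v pK vK pv.
have := subsetP Ca v vC; rewrite !inE vK vC pP pK /= andbT -leqNgt.
have := subsetP Cb v vC; rewrite inE vK /=.
move: h1 h2 a1 a2 b1 b2; rewrite /e; clear; lia.
Qed.

Lemma small_sub U W m : W \subset U -> small G U m -> small G W m.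
Proof. by move=> WU sU C CW; apply: sU; apply: subset_trans WU. Qed.

Lemma closed_nbhdU S T : closed_nbhd G (S :|: T) = closed_nbhd G S :|: closed_nbhd G T.
Proof.
apply/setP=> v; rewrite !inE; apply/existsP/orP.
  by case=> a /andP[]; rewrite inE => /orP[] aS av; [left|right]; apply/existsP; exists a; rewrite aS.
by case=> /existsP[a /andP[aS av]]; exists a; rewrite inE aS ?orbT.
Qed.

(** Components [K] of size at most 2^l need no star. Otherwise take [s] about (4/3)^l: the layers
    cost at most 2 |K| (3/4)^l, and the paths 8 s <= 16 (4/3)^l <= 16 |K| (3/4)^l, because (16/9)^l
    <= 2^l < |K|. *)
Lemma star_halving U l : stringlike U G -> small G U (2 ^ l.+1) ->
  exists S, [/\ S \subset U, #|S| * 4 ^ l <= 18 * #|U| * 3 ^ l & small G (U :\: closed_nbhd G S) (2 ^ l)].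
Proof.
move=> sU smU; have Gsym := stringlike_sym sU.
pose Q (X : {set V}) := X \subset U -> exists S, [/\ S \subset X,
  #|S| * 4 ^ l <= 18 * #|X| * 3 ^ l & small G (X :\: closed_nbhd G S) (2 ^ l)].
apply: (comp_ind Gsym (P := Q)) => // [_|K K0 cK KU|K X dis cut QK QX KXU].
- exists set0; split; rewrite ?cards0 ?sub0set //.
  by move=> C; rewrite set0D subset0 => /eqP->; rewrite cards0.
- case: (leqP #|K| (2 ^ l)) => Kl.
    exists set0; split; rewrite ?cards0 ?sub0set // => C CK _.
    by apply: leq_trans Kl; apply/subset_leq_card/(subset_trans CK)/subsetDl.
  pose s := (4 ^ l %/ 3 ^ l).+1.
  have s1 : 4 ^ l <= s * 3 ^ l by apply/ltnW; rewrite ltn_ceil // expn_gt0.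
  have s2 : s * 3 ^ l <= 2 * 4 ^ l.
    have -> : s * 3 ^ l = 3 ^ l + 4 ^ l %/ 3 ^ l * 3 ^ l by rewrite /s mulSn.
    by rewrite mul2n -addnn leq_add ?leq_trunc_div // leq_expl.
  have [S [x [SK sx Sx sep]]] := star_separator (stringlike_sub KU sU) cK K0 (ltn0Sn _ : 0 < s).
  exists S; split=> //.
    have e1 : x * 4 ^ l <= #|K| * 3 ^ l.
      apply: leq_trans (leq_mul (leqnn x) s1) _.
      by rewrite mulnA leq_mul2r mulnC sx orbT.
    have e2 : s * 4 ^ l <= 2 * #|K| * 3 ^ l.
      have p3 : 0 < 3 ^ l by rewrite expn_gt0.
      rewrite -(leq_pmul2r p3) mulnAC.
      apply: leq_trans (leq_mul s2 (leqnn _)) _; rewrite -!mulnA leq_mul2l /=.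
      apply: (@leq_trans (2 ^ l * (3 ^ l * 3 ^ l))); last by rewrite leq_mul2r ltnW ?orbT.
      by rewrite -!expnMn leq_expl.
    apply: leq_trans (leq_mul Sx (leqnn _)) _; move: e1 e2; clear; lia.
  move=> C CKS cC; have := smU K KU cK; rewrite expnS => Kb.
  have := sep C _ cC _; move: CKS; rewrite subsetD => /andP[CK dC] /(_ CK dC) h.
  by rewrite -(leq_pmul2l (ltn0Sn 1)); apply: leq_trans h Kb.
have [|S1 [S1K b1 m1]] := QK; first exact: subset_trans (subsetUl _ _) KXU.
have [|S2 [S2X b2 m2]] := QX; first exact: subset_trans (subsetUr _ _) KXU.
exists (S1 :|: S2); split; first exact: setUSS.
  rewrite [#|K :|: X|]cardsU (eqP (_ : K :&: X == set0)) ?setI_eq0 // cards0 subn0.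
  have := (leq_card_setU S1 S2).1; move: b1 b2; set p4 := 4 ^ l; set p3 := 3 ^ l; clear; nia.
move=> C; rewrite closed_nbhdU subsetD => /andP[CKX dC] cC; case: (conn_cut cC CKX cut) => h.
  by apply: m1 => //; rewrite subsetD h (disjointWr (subsetUl _ _) dC).
by apply: m2 => //; rewrite subsetD h (disjointWr (subsetUr _ _) dC).
Qed.

(** A geometric series with denominators cleared: the halvings cost 18 |U| (3/4)^i for i from j to j
    + d - 1, and 18 / (1 - 3/4) = 72. *)
Lemma star_division_aux U j d : stringlike U G -> small G U (2 ^ (j + d)) ->
  exists S, [/\ S \subset U,
    #|S| * 4 ^ (j + d) + 72 * #|U| * 3 ^ (j + d) <= 72 * #|U| * (3 ^ j * 4 ^ d) &
    small G (U :\: closed_nbhd G S) (2 ^ j)].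
Proof.
elim: d U => [|d IH] U sU smU.
  exists set0; rewrite addn0 in smU *; split; rewrite ?sub0set ?cards0 ?muln1 ?leqnn //.
  exact: small_sub (subsetDl _ _) smU.
rewrite addnS in smU *.
have [S1 [S1U b1 m1]] := star_halving sU smU.
have DU : U :\: closed_nbhd G S1 \subset U := subsetDl _ _.
have [S2 [S2U b2 m2]] := IH _ (stringlike_sub DU sU) m1.
exists (S1 :|: S2); split.
- by rewrite subUset S1U (subset_trans S2U).
- have := (leq_card_setU S1 S2).1; have := subset_leq_card DU.
  have : 3 ^ (j + d) <= 3 ^ j * 4 ^ d.
    by rewrite expnD leq_mul2l leq_expl ?orbT.
  move: b1 b2; rewrite !expnS.
  set A := 4 ^ (j + d); set B := 3 ^ (j + d); set C := 3 ^ j; set D := 4 ^ d.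
  set u1 := #|_ :\: _|; set u := #|U|; set t := #|S1 :|: S2|; clear.
  move=> b1 b2 BX u1u tt.
  have : #|S2| * A + 72 * u * B <= 72 * u * (C * D).
    rewrite -(subnKC u1u); move: b2; nia.
  move: b1 tt; nia.
- by rewrite closed_nbhdU -setDDl.
Qed.

Lemma star_division U j m : stringlike U G -> small G U m ->
  exists S, [/\ S \subset U, #|S| * 4 ^ j <= 72 * #|U| * 3 ^ j &
    small G (U :\: closed_nbhd G S) (2 ^ j)].
Proof.
(* [m] halvings are enough, since m <= 2^(j + m). *)
move=> sU smU; have [|S [SU bS mS]] := @star_division_aux U j m sU.
  apply: small_le smU; apply: leq_trans (ltnW (ltn_expl m (ltnSn 1))) _.
  by rewrite leq_exp2l // leq_addl.
exists S; split=> //; have p : 0 < 4 ^ m by rewrite expn_gt0.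
rewrite -(leq_pmul2r p) -!mulnA -expnD [X in _ <= X]mulnA.
exact: leq_trans (leq_addr _ _) bS.
Qed.
End Division.

(** * Contraction *)

(** Component size [m], hops [t], [e] edges per vertex. It speaks of all graphs, so that it applies
    to contracted ones. *)
Definition sparsifies (m t e : nat) : Prop :=
  forall (V : finType) (G : rel V) (U : {set V}),
    stringlike U G -> small G U m -> spans G U t (e * #|U|).

Lemma hop_stretch (V : finType) (E E' : {set V * V}) k t u v :
  (forall x y, (x, y) \in E' -> hop E k x y) -> hop E' t u v -> hop E (k * t) u v.
Proof.
move=> EE' [p [pp lp sp]]; apply: (hop_sub (subxx _) (leq_mul (leqnn k) sp)).
elim: p u pp lp {sp} => [|w p IH] u /=; first by move=> _ ->; rewrite muln0; apply: hop0.
move=> /andP[uw pp] lp; rewrite mulnS; apply: hop_trans (IH _ pp lp).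
by case/orP: uw => /EE' // /hop_sym.
Qed.

Section Contraction.
Variables (V : finType) (G : rel V) (U S : {set V}) (m0 : nat) (D : V -> pred pt).
Hypothesis rep : grid_rep U G m0 D.
Hypothesis SU : S \subset U.

Let Gsym := rep_sym rep.
Let X := U :&: closed_nbhd G S.
Let Y := U :&: closed_nbhd G X.

(** One step towards [S]: from [Y] into [X], from [X] into [S]. The default values do not occur on
    [Y]. *)
Definition par v := if v \in S then v else
  if v \in U :&: closed_nbhd G S then odflt v [pick a in S | G a v]
  else odflt v [pick a in U :&: closed_nbhd G S | G a v].

Definition ctr v := par (par v).

Let sub_near (A : {set V}) : A \subset U -> A \subset U :&: closed_nbhd G A.
Proof.
move=> AU; apply/subsetP=> v vA; rewrite !inE (subsetP AU v vA) /=.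
by apply/existsP; exists v; rewrite vA eqxx.
Qed.

Let SX : S \subset X := sub_near SU.
Let XU : X \subset U := subsetIl _ _.
Let XY : X \subset Y := sub_near XU.
Let YU : Y \subset U := subsetIl _ _.

Lemma par_S v : v \in S -> par v = v.
Proof. by rewrite /par => ->. Qed.

Lemma par_X v : v \in X -> par v \in S /\ (par v == v) || G v (par v).
Proof.
rewrite /par => vX; case: ifP => vS; first by rewrite vS eqxx.
rewrite vX; case: pickP => [a /andP[aS av]|no] /=; first by rewrite aS Gsym av orbT.
move: vX; rewrite !inE => /andP[_ /existsP[a /andP[aS /orP[/eqP e|av]]]].
  by rewrite -e aS in vS.
by have := no a; rewrite aS av.
Qed.

Lemma par_Y v : v \in Y -> par v \in X /\ (par v == v) || G v (par v).
Proof.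
move=> vY; case: (boolP (v \in X)) => vX.
  by have [pS h] := par_X vX; split=> //; apply: (subsetP SX).
have vS : v \in S = false by apply: contraNF vX => /(subsetP SX).
rewrite /par vS (negPf vX); case: pickP => [a /andP[aX av]|no] /=.
  by rewrite Gsym av orbT.
move: vY; rewrite inE [v \in closed_nbhd G X]inE => /andP[_ /existsP[a /andP[aX /orP[/eqP e|av]]]].
  by rewrite -e aX in vX.
by have := no a; rewrite aX av.
Qed.

Lemma ctr_Y v : v \in Y -> ctr v \in S.
Proof. by move=> /par_Y[/par_X[]]. Qed.

Lemma ctr_S v : v \in S -> ctr v = v.
Proof. by move=> vS; rewrite /ctr !par_S. Qed.

Lemma ctr_X v : v \in X -> ctr v = par v.
Proof. by move=> /par_X[pS _]; rewrite /ctr par_S. Qed.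

Lemma ctr_par v : v \in Y -> ctr (par v) = ctr v.
Proof. by move=> /par_Y[pX _]; rewrite ctr_X. Qed.

Definition cgraph : rel V := [rel s s' | [&& s \in S, s' \in S, s != s' &
  [exists u in U :&: closed_nbhd G X, exists v in U :&: closed_nbhd G X,
    [&& ctr u == s, ctr v == s' & G u v]]]].

Definition cregion s : pred pt := fun p => [exists u in U :&: closed_nbhd G X, (ctr u == s) && D u p].

Lemma cgraphP s s' : cgraph s s' -> exists u v,
  [/\ u \in Y, v \in Y, ctr u = s, ctr v = s' & G u v].
Proof.
case/and4P=> _ _ _ /existsP[u /andP[uY /existsP[v /andP[vY /and3P[/eqP us /eqP vs uv]]]]].
by exists u, v.
Qed.

Lemma cregion_par u p : u \in Y -> D u p ->
  exists z, D (par u) z /\ gwalk (cregion (ctr u)) p z.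
Proof.
move=> uY Dp; have [pX pu] := par_Y uY; have uU := subsetP YU u uY.
have pU := subsetP XU _ pX.
have [z [Dz Dz']] : exists z, D u z /\ D (par u) z.
  case: (eqVneq u (par u)) => [<-|ne]; first by exists p.
  by apply/(rep_adj rep uU pU ne); rewrite eq_sym (negPf ne) in pu.
exists z; split=> //; apply: gwalk_sub (rep_conn rep uU Dp Dz) => x Dx.
by apply/existsP; exists u; rewrite uY eqxx.
Qed.

Lemma cregion_ctr u p : u \in Y -> D u p ->
  exists z, D (ctr u) z /\ gwalk (cregion (ctr u)) p z.
Proof.
move=> uY Dp; have [z [Dz pz]] := cregion_par uY Dp; have [pX _] := par_Y uY.
have [y [Dy zy]] := cregion_par (subsetP XY _ pX) Dz.
by exists y; split=> //; apply: gwalk_trans pz _; rewrite -(ctr_par uY).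
Qed.

(** The region of a cluster is connected: each string meets that of its parent, and two such steps
    stay in the cluster and reach the centre. *)
Lemma cgraph_rep : grid_rep S cgraph m0 cregion.
Proof.
have SY := subset_trans SX XY.
split.
- suff h s s' : cgraph s s' -> cgraph s' s by move=> s s'; apply/idP/idP; apply: h.
  move=> ss'; have [u [v [uY vY us vs uv]]] := cgraphP ss'; case/and4P: ss' => sS s'S ne _.
  rewrite /cgraph /= sS s'S eq_sym ne; apply/existsP; exists v; rewrite vY.
  by apply/existsP; exists u; rewrite uY us vs !eqxx Gsym uv.
- by move=> s; rewrite /cgraph /= eqxx !andbF.
- by move=> s p _ /existsP[u /and3P[uY _ Dp]]; apply: (rep_box rep) Dp; apply: (subsetP YU).
- move=> s sS; have [p Dp] := rep_ne rep (subsetP SU s sS); exists p.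
  by apply/existsP; exists s; rewrite (subsetP SY s sS) ctr_S // eqxx.
- move=> s p q sS /existsP[u /and3P[uY /eqP us Dp]] /existsP[v /and3P[vY /eqP vs Dq]].
  have [y [Dy py]] := cregion_ctr uY Dp; have [z [Dz qz]] := cregion_ctr vY Dq.
  rewrite us vs in Dy py Dz qz; apply: gwalk_trans py _; apply: gwalk_trans (gwalk_sym qz).
  apply: gwalk_sub (rep_conn rep (subsetP SU s sS) Dy Dz) => x Dx.
  by apply/existsP; exists s; rewrite (subsetP SY s sS) ctr_S // eqxx.
move=> s s' sS s'S ne; split.
  move=> /cgraphP[u [v [uY vY us vs uv]]].
  have ne' : u != v by apply: contraNneq ne => e; rewrite -us -vs e.
  have [p [pu pv]] := (rep_adj rep (subsetP YU u uY) (subsetP YU v vY) ne').1 uv.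
  by exists p; split; apply/existsP; [exists u | exists v]; rewrite ?uY ?vY ?us ?vs eqxx.
move=> [p [/existsP[u /and3P[uY /eqP us pu]] /existsP[v /and3P[vY /eqP vs pv]]]].
have ne' : u != v by apply: contraNneq ne => e; rewrite -us -vs e.
rewrite /cgraph /= sS s'S ne; apply/existsP; exists u; rewrite uY.
apply/existsP; exists v; rewrite vY us vs !eqxx /=.
by apply/(rep_adj rep (subsetP YU u uY) (subsetP YU v vY) ne'); exists p.
Qed.

(** The union of the clusters of a connected [C] is connected in [G] and contains [C]. *)
Lemma cgraph_small m : small G U m -> small cgraph S m.
Proof.
move=> smU C CS cC; have SY := subset_trans SX XY.
pose B := [set u in Y | ctr u \in C].
have CB : C \subset B.
  apply/subsetP=> s sC; have sS := subsetP CS s sC.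
  by rewrite inE (subsetP SY s sS) ctr_S.
apply: leq_trans (subset_leq_card CB) _; apply: smU.
  by apply/subsetP=> u; rewrite inE => /andP[/(subsetP YU)].
have up u : u \in B -> par u \in B /\ connect (restr G B) u (par u).
  rewrite inE => /andP[uY uC]; have [pX pu] := par_Y uY.
  have pB : par u \in B by rewrite inE (subsetP XY _ pX) ctr_par.
  split=> //; case/orP: pu => [/eqP->|pu]; first exact: connect0.
  by apply: connect1; rewrite /restr /= pB inE uY uC.
have top u : u \in B -> connect (restr G B) u (ctr u).
  by move=> uB; have [pB h] := up u uB; apply: connect_trans h _; have [] := up _ pB.
have csym := restr_csym Gsym B.
have edge s s' : restr cgraph C s s' -> connect (restr G B) s s'.
  case/and3P=> sC s'C /cgraphP[u [v [uY vY us vs uv]]].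
  have uB : u \in B by rewrite inE uY us.
  have vB : v \in B by rewrite inE vY vs.
  apply: (connect_trans (y := u)); first by rewrite csym -us top.
  apply: (connect_trans (y := v)); last by rewrite -vs top.
  by apply: connect1; rewrite /restr /= uB vB.
move=> u v uB vB; apply: connect_trans (top u uB) _.
rewrite csym; apply: connect_trans (top v vB) _.
move: uB vB; rewrite !inE => /andP[_ uC] /andP[_ vC].
exact: connect_sub edge _ _ (cC _ _ vC uC).
Qed.

(** An edge with an end [u] in [X] has its other end in [Y]: one hop leads from [u] to its centre
    and two from the other end. A contracted edge expands to 2 + 1 + 2 = 5 hops. The parent edges
    number at most |U|. *)
Lemma contraction_peel m t h : small G U m -> sparsifies m t h ->
  peels G U (U :\: closed_nbhd G S) (5 * t + 3) (#|U| + h * #|S|).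
Proof.
move=> smU spars; split; first exact: subsetDl.
have [|E' [inE' cE' cov']] := spars V cgraph S _ (cgraph_small smU).
  by exists m0, cregion; apply: cgraph_rep.
pose E1 := [set e | [&& e.1 \in Y, G e.1 e.2 & e.2 == par e.1]].
(* One edge of [G] stands for each contracted edge; the default does not occur on [E']. *)
pose real e := odflt e
  [pick f | [&& f.1 \in Y, f.2 \in Y, ctr f.1 == e.1, ctr f.2 == e.2 & G f.1 f.2]].
have realP s s' : (s, s') \in E' -> exists u v,
    [/\ real (s, s') = (u, v), [/\ u \in Y & v \in Y], ctr u = s, ctr v = s' & G u v].
  move=> /inE'/cgraphP[u [v [uY vY us vs uv]]]; rewrite /real; case: pickP => [[a b]|no] /=.
    by case/and5P=> aY bY /eqP as_ /eqP bs ab; exists a, b.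
  by have := no (u, v); rewrite /= uY vY us vs !eqxx uv.
exists (E1 :|: real @: E'); split.
- apply: edges_inU => u v; first by rewrite inE => /and3P[].
  by case/imsetP=> -[s s'] /realP[a [b [-> _ _ _ ab]]] [-> ->].
- apply: leq_trans (leq_card_setU _ _) _; apply: leq_add; last first.
    exact: leq_trans (leq_imset_card _ _) _.
  rewrite -[#|U|]mul1n; apply: card_out_edges => [u v|u _].
    by rewrite inE => /and3P[/(subsetP YU)].
  rewrite -(cards1 (par u)); apply/subset_leq_card/subsetP=> v.
  by rewrite !inE => /and3P[].
set E := E1 :|: _.
have hop_par v : v \in Y -> hop E 1 v (par v).
  move=> vY; have [_ /orP[/eqP->|pv]] := par_Y vY.
    exact: hop_sub (subxx _) (leqW (leqnn 0)) (hop0 _ _).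
  by apply: hop1; rewrite inE inE vY pv eqxx.
have hop_ctr v : v \in Y -> hop E 2 v (ctr v).
  move=> vY; apply: (hop_trans (s := 1) (t := 1) (hop_par v vY)); apply: hop_par.
  by have [/(subsetP XY)] := par_Y vY.
have stretch s s' : (s, s') \in E' -> hop E 5 s s'.
  move=> ss'; have [u [v [e [uY vY] us vs uv]]] := realP s s' ss'.
  apply: (hop_trans (s := 2) (t := 3) (v := u)); first by rewrite -us; apply/hop_sym/hop_ctr.
  apply: (hop_trans (s := 1) (t := 2) (v := v)); last by rewrite -vs; apply: hop_ctr.
  by apply: hop1; rewrite inE -e imset_f ?orbT.
rewrite setDDr setDv set0U => u v uX vU uv.
have uY : u \in Y := subsetP XY u uX.
have vY : v \in Y.
  rewrite inE vU inE; apply/existsP; exists u; rewrite uv orbT andbT; exact: uX.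
have hu : hop E 1 u (ctr u) by rewrite ctr_X //; apply: hop_par.
have hv : hop E 2 (ctr v) v by apply/hop_sym/hop_ctr.
rewrite addnC -[3]/(1 + 2) -addnA; apply: hop_trans hu _; rewrite addnC.
apply: hop_trans hv; case: (eqVneq (ctr u) (ctr v)) => [->|ne].
  exact: hop_sub (subxx _) (leq0n _) (hop0 _ _).
apply: (hop_stretch stretch); apply: cov'; rewrite ?ctr_Y //.
rewrite /cgraph /= !ctr_Y // ne; apply/existsP; exists u; rewrite uY.
by apply/existsP; exists v; rewrite vY !eqxx uv.
Qed.

End Contraction.

(** Since |S| <= 72 |U| (3/4)^j, the contracted spanner has at most 72 |U| edges; the parent edges
    make it 73. *)
Lemma peel_by_contraction m t h j : sparsifies m t h -> h * 3 ^ j <= 4 ^ j ->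
  forall (V : finType) (G : rel V) (U : {set V}), stringlike U G -> small G U m ->
    exists W, peels G U W (5 * t + 3) (73 * #|U|) /\ small G W (2 ^ j).
Proof.
move=> spars hj V G U sU smU; have [S [SU bS smW]] := star_division j sU smU.
case: sU => m0 [D rep]; exists (U :\: closed_nbhd G S); split=> //.
have [sub [E [inE cE cov]]] := contraction_peel rep SU smU spars; split=> //.
exists E; split=> //; apply: leq_trans cE _; rewrite -[73]/(1 + 72) mulnDl mul1n leq_add2l.
have p3 : 0 < 3 ^ j by rewrite expn_gt0.
rewrite -(leq_pmul2r p3) mulnAC; apply: leq_trans bS.
by rewrite mulnC leq_mul2l hj orbT.
Qed.

(** * Iteration *)

Lemma sparsifies_le m m' t e e' : m <= m' -> e <= e' -> sparsifies m' t e -> sparsifies m t e'.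
Proof.
move=> mm' ee' h V G U sU smU; have [E [inE cE cov]] := h V G U sU (small_le mm' smU).
by exists E; split=> //; apply: leq_trans cE _; rewrite leq_mul2r ee' orbT.
Qed.

(** A vertex and its neighbours form a connected set, so degrees are bounded by [m] and all edges
    can be kept. *)
Lemma sparsifies_trivial m t : 0 < t -> sparsifies m t m.
Proof.
move=> t0 V G U sU smU; have Gsym := stringlike_sym sU.
exists [set e | [&& e.1 \in U, e.2 \in U & G e.1 e.2]]; split.
- by move=> u v; rewrite inE => /and3P[].
- apply: card_out_edges => [u v|u uU]; first by rewrite inE => /and3P[].
  pose N := u |: [set v in U | G u v].
  apply: (@leq_trans #|N|).
    by apply/subset_leq_card/subsetP=> v; rewrite !inE /= => /and3P[_ -> ->]; rewrite orbT.
  apply: smU; first by apply/subsetP=> v; rewrite !inE => /orP[/eqP->|/andP[]].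
  have hub v : v \in N -> connect (restr G N) u v.
    move=> vN; move: (vN); rewrite !inE => /orP[/eqP->|/andP[vU uv]]; first exact: connect0.
    by apply: connect1; rewrite /restr /= vN setU11 uv.
  move=> x y /hub ux /hub uy; apply: connect_trans uy; by rewrite restr_csym.
- move=> u v uU vU uv; apply: hop_sub (subxx _) t0 _.
  by apply: hop1; rewrite inE uU vU.
Qed.

Lemma sparsifies_log l : sparsifies (2 ^ l) 3 (40 * l).
Proof. by move=> V G U sU smU; rewrite mulnAC; apply: spans_logarithm. Qed.

(** For the least [j] with h <= (4/3)^j, minimality and 2 <= (4/3)^3 give 2^(j - 1) <= h^3 when j >
    0. *)
Lemma exp_between h : 0 < h -> exists j, h * 3 ^ j <= 4 ^ j /\ 2 ^ j <= 2 * h ^ 3.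
Proof.
(* Bernoulli's inequality 1 + j/3 <= (4/3)^j. *)
move=> h0; have bern j : (3 + j) * 3 ^ j <= 3 * 4 ^ j.
  by elim: j => // j IH; rewrite !expnS; move: IH; set x := 3 ^ j; set y := 4 ^ j; nia.
have ex : exists j, h * 3 ^ j <= 4 ^ j.
  exists (3 * h); rewrite -(leq_pmul2l (_ : 0 < 3)) //; apply: leq_trans (bern _).
  by rewrite mulnA leq_mul2r leq_addl orbT.
case: (ex_minnP ex) => j hj jmin; exists j; split=> //.
case: j hj jmin => [|j] _ jmin; first by rewrite muln_gt0 /= expn_gt0 h0.
rewrite expnS leq_mul2l /=.
have lt : 4 ^ j < h * 3 ^ j by rewrite ltnNge; apply/negP => /jmin; rewrite ltnn.
have : (4 ^ j) ^ 3 <= (h * 3 ^ j) ^ 3 by rewrite leq_exp2r // ltnW.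
have p27 : 0 < (3 ^ 3) ^ j by rewrite !expn_gt0.
rewrite expnMn -!expnM ![j * 3]mulnC [3 ^ _]expnM [4 ^ _]expnM => h3.
rewrite -(leq_pmul2r p27); apply: leq_trans h3; rewrite -expnMn; exact: leq_expl.
Qed.

(** With u = l %/ 4 + 1 one has u^4 <= 2^l and (l + 1)^3 <= 64 u^3; the bound on [l] ensures 64 K <=
    u. *)
Lemma exp_dominates_cube K : exists L, forall l, L <= l -> K * l.+1 ^ 3 <= 2 ^ l.
Proof.
exists (4 * (64 * K)) => l Ll.
pose u := (l %/ 4).+1.
have lu : l.+1 <= 4 * u by rewrite /u mulnC ltn_ceil.
have Ku : 64 * K <= u by rewrite /u leqW // leq_divRL // mulnC.
apply: (@leq_trans (u ^ 4)); last first.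
  apply: (@leq_trans ((2 ^ (l %/ 4)) ^ 4)); first by rewrite leq_exp2r // ltn_expl.
  by rewrite -expnM leq_exp2l // leq_trunc_div.
apply: leq_trans (leq_mul (leqnn K) (_ : _ <= (4 * u) ^ 3)) _; first by rewrite leq_exp2r.
by rewrite expnMn mulnA [K * _]mulnC [u ^ 4]expnS leq_mul2r Ku orbT.
Qed.

(** For y = a m, the left side bounds the component size after two contractions. The inner [a] sees
    a polynomial in [y], so the whole is polylogarithmic in [y]. *)
Lemma double_log_growth (a : nat -> nat) C : (forall m l, m <= 2 ^ l -> a m <= l) ->
  exists M, forall y, 2 * (C * (a (2 * (C * y.+1) ^ 3)).+1) ^ 3 <= maxn M y.
Proof.
move=> alog; pose B := 3 * C + 8.
(* The successor gives a strict inequality, which turns the bound [y.+1] into [y]. *)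
have [L Lp] := exp_dominates_cube (2 * (C * B) ^ 3).+1.
exists (2 * (C * (B * L.+1)) ^ 3) => y.
pose l := trunc_log 2 y.+1.
have l1 : 2 ^ l <= y.+1 by apply: trunc_logP.
have l2 : y.+1 <= 2 ^ l.+1 by apply/ltnW/trunc_log_ltn.
have al : (a (2 * (C * y.+1) ^ 3)).+1 <= B * l.+1.
  have : a (2 * (C * y.+1) ^ 3) <= 1 + (C + l.+1) * 3.
    apply: alog; rewrite expnD leq_mul2l /= expnM leq_exp2r // expnD leq_mul //.
    by apply/ltnW/ltn_expl.
  by rewrite /B; nia.
have step x : (a (2 * (C * y.+1) ^ 3)).+1 <= x ->
    2 * (C * (a (2 * (C * y.+1) ^ 3)).+1) ^ 3 <= 2 * (C * x) ^ 3.
  by move=> h; rewrite leq_mul2l leq_exp2r // leq_mul2l h orbT.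
rewrite leq_max; case: (leqP L l) => Ll; apply/orP; [right|left]; last first.
  by apply: step; apply: leq_trans al _; rewrite leq_mul2l ltnS ltnW ?orbT.
apply: leq_trans (step _ al) _; rewrite -ltnS; apply: leq_trans l1; apply: leq_trans (Lp l Ll).
have -> : 2 * (C * (B * l.+1)) ^ 3 = 2 * (C * B) ^ 3 * l.+1 ^ 3 by rewrite !expnMn !mulnA.
by rewrite (mulSn (2 * _)) -[X in X <= _]add1n leq_add2r expn_gt0.
Qed.

(* Two contractions reduce the component size from m to max M (a m): one reduces it to a
   polynomial in a m, and a of that is logarithmic in a m. *)
Lemma sparsifies_iter (a : nat -> nat) C t : (forall m l, m <= 2 ^ l -> a m <= l) ->
  (forall m, sparsifies m t (C * (a m).+1)) ->
  exists C', forall i m, iter i a m <= 1 -> sparsifies m (5 * t + 3) (C' * i.+1).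
Proof.
move=> alog spars; pose c := C.+1.
have spars' m : sparsifies m t (c * (a m).+1).
  by apply: (sparsifies_le (leqnn _) _ (spars m)); rewrite leq_mul2r leqnSn orbT.
have peel (V : finType) (G : rel V) (U : {set V}) m : stringlike U G -> small G U m ->
    exists W, peels G U W (5 * t + 3) (73 * #|U|) /\ small G W (2 * (c * (a m).+1) ^ 3).
  move=> sU smU; have h0 : 0 < c * (a m).+1 by rewrite muln_gt0.
  have [j [j1 j2]] := exp_between h0.
  have [W [pW sW]] := peel_by_contraction (spars' m) j1 sU smU.
  by exists W; split=> //; apply: small_le sW.
have [M growth] := double_log_growth c alog.
(* Both contractions use the same [t]-hop hypothesis, so the hop bound does not grow with the
   rounds; 146 = 73 + 73. *)
have step m e : sparsifies (maxn M (a m)) (5 * t + 3) e -> sparsifies m (5 * t + 3) (146 + e).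
  move=> h V G U sU smU; have Gsym := stringlike_sym sU.
  have [W1 [p1 s1]] := peel V G U m sU smU; have W1U : W1 \subset U by case: p1.
  have [W2 [p2 s2]] := peel V G W1 _ (stringlike_sub W1U sU) s1.
  have W2W1 : W2 \subset W1 by case: p2.
  have W2U := subset_trans W2W1 W1U.
  have := peels_spans Gsym (peels_trans Gsym p1 p2)
    (h V G W2 (stringlike_sub W2U sU) (small_le (growth _) s2)).
  case=> E [inE cE cov]; exists E; split=> //; apply: leq_trans cE _.
  rewrite mulnDl leq_add //; last by rewrite leq_mul2l (subset_leq_card W2U) orbT.
  by rewrite -[146]/(73 + 73) mulnDl leq_add2l leq_mul2l (subset_leq_card W1U).
have base m : m <= M.+1 -> sparsifies m (5 * t + 3) M.+1.
  move=> mM; apply: (sparsifies_le mM (leqnn _)); apply: sparsifies_trivial.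
  by rewrite addnS.
exists (147 + M) => i m im.
suff : sparsifies m (5 * t + 3) (146 * i + M.+1).
  by apply: sparsifies_le => //; nia.
elim: i m im => [|i IH] m; first by move=> m1; apply: base; apply: leq_trans m1 _.
rewrite iterSr => im; rewrite mulnS -addnA; apply: step.
(* Either the size is [a m] and the count of iterations drops by one, or it is [M] and all edges are
   kept. *)
rewrite /maxn; case: ifP => _; first exact: IH.
by apply: (sparsifies_le (leqnSn M) (leq_addl _ _)); apply: base.
Qed.

Require Import Defs.
From mathcomp Require Import all_boot all_order all_algebra.
From mathcomp Require Import all_classical all_reals all_analysis.
From mathcomp Require Import Rstruct Rstruct_topology.
From mathcomp Require Import lra.
Import Order.TTheory GRing.Theory Num.Theory.
Import numFieldNormedType.Exports.
Local Open Scope classical_set_scope.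
Local Open Scope ring_scope.

(** * Discretization of curves *)

Section Discretization.
Variable R : realType.
Implicit Types (x y : R * R) (K L : set (R * R)) (a b : R) (p q : pt).

(** The set of differences x - y is compact, hence closed, and misses 0. *)
Lemma compacts_apart K L : compact K -> compact L -> K `&` L = set0 ->
  exists2 e : R, 0 < e & forall x y, K x -> L y -> `|x.1 - y.1| < e -> `|x.2 - y.2| < e -> False.
Proof.
move=> cK cL KL0; pose f (z : (R * R) * (R * R)) : R * R := z.1 - z.2.
have cf : continuous f by move=> z; apply: cvgB; [exact: cvg_fst | exact: cvg_snd].
have cI : compact (f @` (K `*` L)).
  by apply: continuous_compact; [exact: continuous_subspaceT | exact: compact_setX].
have clI : closed (f @` (K `*` L)) := compact_closed (@norm_hausdorff _ _) cI.
have /nbhs_ballP[e /= e0 eP] : nbhs (0 : R * R) (~` (f @` (K `*` L))).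
  apply: open_nbhs_nbhs; split; first exact: closed_openC.
  case=> -[x y] [/= Kx Ly] /eqP; rewrite /f /= subr_eq0 => /eqP xy.
  have : (K `&` L) x by split=> //; rewrite xy.
  by rewrite KL0.
exists e => // x y Kx Ly h1 h2; apply: (eP (x - y)); last by exists (x, y).
by split=> /=; rewrite /ball /= sub0r normrN.
Qed.

(* near1 a i uses sup-distance 1, so a real number has two or three near integers and nearby
   reals share one: the cells along a connected set form a connected set of grid points. *)
Definition near1 a (i : nat) := `|a - i%:R| <= 1.

Definition cell (T : R * R -> R * R) x : pred pt :=
  fun p => `[< near1 (T x).1 p.1 /\ near1 (T x).2 p.2 >].

Lemma near1_truncn a : 0 <= a -> near1 a (Num.truncn a).
Proof. by move=> /truncn_itv/andP[h1 h2]; rewrite /near1 ger0_norm; move: h1 h2; rewrite -natr1; lra. Qed.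

Lemma near1_truncn2 a b : 0 <= a -> 0 <= b -> `|a - b| < 1 -> a <= b ->
  near1 a (Num.truncn b).
Proof.
move=> a0 b0 ab h; have /andP[h1 h2] := truncn_itv b0; move: ab h1 h2; rewrite -natr1 /near1.
rewrite ler_norml ltr_norml; lra.
Qed.

Lemma near1_common a b : 0 <= a -> 0 <= b -> `|a - b| < 1 -> exists i, near1 a i /\ near1 b i.
Proof.
move=> a0 b0 ab; case: (leP a b) => h.
  by exists (Num.truncn b); split; [apply: near1_truncn2 | apply: near1_truncn].
exists (Num.truncn a); split; first exact: near1_truncn.
by apply: near1_truncn2 => //; [rewrite distrC | apply: ltW].
Qed.

Lemma near1_truncn_adj a i : 0 <= a -> near1 a i ->
  [\/ i = Num.truncn a, i = (Num.truncn a).+1 | (Num.truncn a) = i.+1].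
Proof.
move=> a0; rewrite /near1 ler_norml => /andP[n1 n2].
have /andP[] := truncn_itv a0; move: (Num.truncn a) => k; rewrite -natr1 => k1 k2.
have : (i%:R : R) < (k.+2)%:R by rewrite -!natr1; lra.
rewrite ltr_nat ltnS => ik.
have : (k%:R : R) <= (i.+1)%:R by rewrite -natr1; lra.
rewrite ler_nat => ki.
move: ik; rewrite leq_eqVlt => /orP[/eqP->|]; first by constructor 2.
rewrite ltnS leq_eqVlt => /orP[/eqP->|ik]; first by constructor 1.
by constructor 3; apply/eqP; rewrite eqn_leq ki.
Qed.

Lemma cell_center (T : R * R -> R * R) x p : 0 <= (T x).1 -> 0 <= (T x).2 -> cell T x p ->
  gwalk (cell T x) p (Num.truncn (T x).1, Num.truncn (T x).2).
Proof.
move=> T1 T2 /asboolP[n1 n2]; case: p n1 n2 => i j /= n1 n2.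
have c1 := near1_truncn T1; have c2 := near1_truncn T2.
apply: (@gwalk_trans _ _ (Num.truncn (T x).1, j)).
  have ci : cell T x (i, j) by apply/asboolP.
  have ck : cell T x (Num.truncn (T x).1, j) by apply/asboolP.
  case: (near1_truncn_adj T1 n1) => e; first by rewrite -e; apply: gwalk_refl.
    by apply: gwalk_step => //; rewrite e /gadj /= !eqxx !orbT.
  by apply: gwalk_step => //; rewrite e /gadj /= !eqxx !orbT.
have ci : cell T x (Num.truncn (T x).1, j) by apply/asboolP.
have ck : cell T x (Num.truncn (T x).1, Num.truncn (T x).2) by apply/asboolP.
case: (near1_truncn_adj T2 n2) => e; first by rewrite -e; apply: gwalk_refl.
  by apply: gwalk_step => //; rewrite e /gadj /= !eqxx ?orbT.
by apply: gwalk_step => //; rewrite e /gadj /= !eqxx ?orbT.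
Qed.

Definition trace (T : R * R -> R * R) K : pred pt := fun p => `[< exists2 x, K x & cell T x p >].

(** Points of [K] at distance below 1/M have a common grid point in their cells, so the points whose
    cells are reachable from [p] form an open and closed part of [K]. *)
Lemma trace_connected (M B : R) K p q : 0 < M ->
  let T x := (M * (x.1 + B) + 2, M * (x.2 + B) + 2) in
  connected K -> (forall x, K x -> 0 <= (T x).1 /\ 0 <= (T x).2) ->
  trace T K p -> trace T K q -> gwalk (trace T K) p q.
Proof.
move=> M0 T cK Tpos /asboolP[x0 Kx0 px0] /asboolP[y0 Ky0 qy0].
have in_trace x : K x -> forall r r', cell T x r -> cell T x r' -> gwalk (trace T K) r r'.
  move=> Kx r r' rx r'x; have [t1 t2] := Tpos x Kx.
  apply: (@gwalk_sub (cell T x)) => [z zx|]; first by apply/asboolP; exists x.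
  exact: gwalk_trans (cell_center t1 t2 rx) (gwalk_sym (cell_center t1 t2 r'x)).
pose A : set (R * R) := [set x | K x /\ exists2 r, cell T x r & gwalk (trace T K) p r].
have scale (s t : R) : `|s - t| < M^-1 -> `|(M * (s + B) + 2) - (M * (t + B) + 2)| < 1.
  move=> st; have -> : M * (s + B) + 2 - (M * (t + B) + 2) = M * (s - t) by lra.
  by rewrite normrM gtr0_norm // -(mulfV (lt0r_neq0 M0)) ltr_pM2l.
have local x y : K x -> K y -> ball x M^-1 y -> A x -> A y.
  move=> Kx Ky [b1 b2] [_ [r rx pr]]; split=> //.
  have [tx1 tx2] := Tpos x Kx; have [ty1 ty2] := Tpos y Ky.
  have [i [i1 i2]] := near1_common tx1 ty1 (scale _ _ b1).
  have [j [j1 j2]] := near1_common tx2 ty2 (scale _ _ b2).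
  exists (i, j); first by apply/asboolP.
  by apply: gwalk_trans pr _; apply: (in_trace x) => //; apply/asboolP.
have Mi : 0 < M^-1 by rewrite invr_gt0.
have openU (S : set (R * R)) : open (\bigcup_(x in S) ball x M^-1).
  by apply: bigcup_open => x _; apply: ball_open.
have AK : A = K.
  apply: cK.
  - by exists x0; split=> //; exists p => //; apply: gwalk_refl; apply/asboolP; exists x0.
  - exists (\bigcup_(x in A) ball x M^-1) => //; apply/seteqP; split=> y.
      by move=> Ay; split; [case: Ay | exists y => //; apply: ballxx].
    by move=> [Ky [x Ax xy]]; apply: (local x) => //; case: Ax.
  exists (~` \bigcup_(x in K `\` A) ball x M^-1); first exact: open_closedC.
  apply/seteqP; split=> y.
    move=> Ay; split; first by case: Ay.
    by move=> [x [Kx nAx] xy]; apply: nAx; apply: (local y) => //; [case: Ay | apply: ball_sym].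
  move=> [Ky ny]; apply: contrapT => nAy; apply: ny; exists y; first by split.
  exact: ballxx.
have [_ [r ry pr]] : A y0 by rewrite AK.
by apply: gwalk_trans pr _; apply: (in_trace y0).
Qed.

End Discretization.

(** * Grid representations of families of curves *)

Section Curves.
Variable R : realType.

Lemma compact_box (L : set (R * R)) : compact L ->
  exists b : nat, forall x, L x -> `|x.1| <= b%:R /\ `|x.2| <= b%:R.
Proof.
move=> /compact_bounded[N [Nreal NP]].
exists (Num.truncn `|N|).+2 => x Lx.
have lt : N < (Num.truncn `|N|).+2%:R.
  have /andP[_ h] := truncn_itv (normr_ge0 N).
  by apply: le_lt_trans (ler_norm N) _; apply: lt_trans h _; rewrite ltr_nat.
have /= := NP _ lt x Lx; rewrite prod_normE ge_max => /andP[]; by split.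
Qed.

Lemma near1_range (M B a : R) (m i : nat) : 0 < M -> `|a| <= B -> 2 * M * B + 4 < m%:R ->
  near1 (M * (a + B) + 2) i -> (0 < i < m)%N.
Proof.
move=> M0 aB mB; rewrite /near1 ler_norml => /andP[n1 n2].
move: aB; rewrite ler_norml => /andP[a1 a2].
have h1 : 0 <= M * (a + B) by apply: mulr_ge0; [exact: ltW | lra].
have h2 : M * (a + B) <= M * (2 * B) by rewrite ler_pM2l //; lra.
apply/andP; split; first by rewrite -(ltr_nat R); lra.
by rewrite -(ltr_nat R); lra.
Qed.

Lemma curves_stringlike (V : finType) (G : rel V) (U : {set V}) (c : V -> R -> R * R) :
  (forall v, {within `[0, 1], continuous (c v)}) -> irreflexive G ->
  (forall u v, u != v ->
     (G u v <-> (c u @` `[0, 1]) `&` (c v @` `[0, 1]) !=set0)) ->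
  stringlike U G.
Proof.
move=> cc irr adj.
pose K v : set (R * R) := c v @` `[0, 1].
have cK v : compact (K v) by apply: continuous_compact (cc v) _; apply: segment_compact.
have nK v : connected (K v).
  by apply: connected_continuous_connected (cc v); apply: segment_connected.
have /choice[b bP] v := compact_box (cK v).
have /choice[e eP] : forall uv : V * V, exists e : R, 0 < e /\ (K uv.1 `&` K uv.2 = set0 ->
    forall x y, K uv.1 x -> K uv.2 y -> `|x.1 - y.1| < e -> `|x.2 - y.2| < e -> False).
  move=> [u v] /=; case: (pselect (K u `&` K v = set0)) => [uv0|]; last by exists 1.
  by have [e e0 eP] := compacts_apart (cK u) (cK v) uv0; exists e.
(* Points whose cells share a grid point are within 2/M in each coordinate; this is less than the
   gap between any two disjoint curves. *)
pose M : R := (\max_uv Num.truncn (2 / e uv)).+1%:R.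
pose B : R := (\max_v b v)%:R.
have M0 : 0 < M by rewrite ltr0n.
have eM uv : 2 < M * e uv.
  have [e0 _] := eP uv; rewrite -ltr_pdivrMr //.
  have /andP[_ h] : _ := truncn_itv (ltW (divr_gt0 (ltr0n _ 2) e0)).
  by apply: lt_le_trans h _; rewrite ler_nat ltnS; apply: leq_bigmax.
have boxB v x : K v x -> `|x.1| <= B /\ `|x.2| <= B.
  move=> Kx; have [h1 h2] := bP v x Kx.
  have bB : (b v)%:R <= B by rewrite ler_nat; apply: leq_bigmax.
  by split; [apply: le_trans h1 bB | apply: le_trans h2 bB].
(* The shift by 2 keeps cells, which have radius 1, off the coordinate axes. *)
pose T (x : R * R) := (M * (x.1 + B) + 2, M * (x.2 + B) + 2).
have T2 v x : K v x -> 2 <= (T x).1 /\ 2 <= (T x).2.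
  move=> Kx; have [h1 h2] := boxB v x Kx.
  by split; rewrite /T /= lerDr; apply: mulr_ge0; rewrite ?ler0n //;
    [move: h1 | move: h2]; rewrite ler_norml; lra.
have [m mP] : exists m : nat, 2 * M * B + 4 < m%:R.
  exists (Num.truncn `|2 * M * B + 4|).+1.
  have /andP[_] := truncn_itv (normr_ge0 (2 * M * B + 4)).
  exact/le_lt_trans/ler_norm.
have T0 v x : K v x -> 0 <= (T x).1 /\ 0 <= (T x).2.
  by move=> /T2[h1 h2]; split; apply: le_trans _ h1 || apply: le_trans _ h2.
have flip u v : u != v -> G u v -> G v u.
  by move=> ne /(adj _ _ ne)[x [Kux Kvx]]; apply/adj; [rewrite eq_sym | exists x].
have Gsym : symmetric G.
  move=> u v; case: (eqVneq u v) => [->//|ne].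
  by apply/idP/idP; apply: flip; rewrite // eq_sym.
exists m, (fun v => trace T (K v)); split=> //.
- move=> v p _ /asboolP[x Kx /asboolP[n1 n2]]; have [h1 h2] := boxB v x Kx.
  by rewrite (near1_range M0 h1 mP n1) (near1_range M0 h2 mP n2).
- move=> v _; have K0 : K v (c v 0) by exists 0 => //=; rewrite in_itv /= lexx ler01.
  have [t1 t2] := T0 v _ K0.
  exists (Num.truncn (T (c v 0)).1, Num.truncn (T (c v 0)).2).
  by apply/asboolP; exists (c v 0) => //; apply/asboolP; split; apply: near1_truncn.
- by move=> v p q _; apply: trace_connected => // x; apply: T0.
move=> u v _ _ ne; split.
  move=> /(adj _ _ ne)[x [Kux Kvx]]; have [t1 t2] := T0 u x Kux.
  exists (Num.truncn (T x).1, Num.truncn (T x).2).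
  by split; apply/asboolP; exists x => //; apply/asboolP; split; apply: near1_truncn.
move=> [p [/asboolP[x Kx /asboolP[x1 x2]] /asboolP[y Ky /asboolP[y1 y2]]]].
apply/(adj _ _ ne); apply/set0P/eqP => uv0.
have [e0 far] := eP (u, v).
have close s t i : near1 (M * (s + B) + 2) i -> near1 (M * (t + B) + 2) i -> `|s - t| < e (u, v).
  rewrite /near1 => h1 h2; rewrite -(ltr_pM2l M0); apply: le_lt_trans (eM _).
  rewrite -[X in X * _ <= _](gtr0_norm M0) -normrM; move: h1 h2; rewrite !ler_norml mulrBr; lra.
by apply: (far uv0 x y) => //; [apply: close x1 y1 | apply: close x2 y2].
Qed.

End Curves.

Lemma string_graph_stringlike (V : finType) (G : rel V) (U : {set V}) :
  string_graph G -> stringlike U G.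
Proof.
move=> [irr [c [cc adj]]]; apply: (@curves_stringlike _ V G U c cc _ adj).
by move=> v; apply/negbTE.
Qed.

(** * Inverse Ackermann functions *)

Local Close Scope classical_set_scope.

Lemma iter_count_le (f : R -> R) x i : iter i f x <= 1 -> (iter_count f x <= i)%N.
Proof.
move=> h; rewrite /iter_count; case: pselect => [ex|//].
by case: ex_minnP => j _; apply.
Qed.

Lemma iter_countP (f : R -> R) x i : iter i f x <= 1 -> iter (iter_count f x) f x <= 1.
Proof.
move=> h; rewrite /iter_count; case: pselect => [ex|no]; last by case: no; exists i.
by case: ex_minnP.
Qed.

(** The index is shifted: this is the value of [alpha k.+1] at [n], as a natural number. *)
Definition alphan (k n : nat) : nat := iter_count (alpha k) n%:R.

Lemma iter_alphan k i n : iter i (alpha k.+1) n%:R = (iter i (alphan k) n)%:R.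
Proof. by elim: i => //= i ->. Qed.

Lemma iter_half i n : iter i (alpha 0) n%:R = n%:R / 2 ^+ i.
Proof.
by elim: i => [|i /= ->]; rewrite ?expr0 ?divr1 // exprS invfM mulrA mulrAC.
Qed.

(** Ensures that the default 0 of [iter_count] is never taken at natural numbers. One application of
    [alpha k.+1] brings [n] down to at most l + 1 <= 2^l when n <= 2^(l + 1). *)
Lemma alpha_reach k l n : (n <= 2 ^ l)%N -> exists2 i, (i <= l)%N & iter i (alpha k) n%:R <= 1.
Proof.
elim: k l n => [|k IH] l n nl.
  by exists l; rewrite // iter_half ler_pdivrMr ?exprn_gt0 // mul1r -natrX ler_nat.
elim: l n nl => [|l IHl] n nl; first by exists 0%N; rewrite //= lern1.
have [i il h] := IH l.+1 n nl.
have [j jl hj] : exists2 i, (i <= l)%N & iter i (alpha k.+1) (alphan k n)%:R <= 1.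
  apply: IHl; apply: leq_trans (iter_count_le h) _; apply: leq_trans il _.
  exact: ltn_expl.
by exists j.+1; rewrite // iterSr.
Qed.

Lemma alphan_log k n l : (n <= 2 ^ l)%N -> (alphan k n <= l)%N.
Proof. by move=> /(alpha_reach k)[i il h]; apply: leq_trans (iter_count_le h) il. Qed.

Lemma alphanP k n : iter (alphan k n) (alpha k) n%:R <= 1.
Proof. by have [i _ h] := alpha_reach k (ltnW (ltn_expl n (ltnSn 1))); apply: iter_countP h. Qed.

Lemma alphan_gt0 k n : (1 < n)%N -> (0 < alphan k n)%N.
Proof.
move=> n1; rewrite lt0n; apply/eqP => e; have := alphanP k n.
by rewrite e /= lern1 leqNgt n1.
Qed.

Definition hops (k : nat) : nat := ((3 * (5 ^ k - 1)) %/ 4)%N.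

(** 4 divides 5^k - 1, so the division in [hops] is exact. *)
Lemma hopsS k : hops k.+1 = (5 * hops k + 3)%N.
Proof.
have [q e] : exists q, (5 ^ k = 4 * q + 1)%N.
  by elim: k => [|k [q e]]; [exists 0%N | exists (5 * q + 1)%N; rewrite expnS e; lia].
by rewrite /hops expnS e; lia.
Qed.

(** Starts from the logarithmic 3-hop spanners. [alphan k.+1 m] counts the iterations of [alphan k],
    which is the [i] in [sparsifies_iter]. *)
Lemma sparsifies_alphan k : exists C, forall m, sparsifies m (hops k.+1) (C * (alphan k m).+1).
Proof.
elim: k => [|k [C IH]].
  exists 40%N => m; have ml : (m <= 2 ^ alphan 0 m)%N.
    by have := alphanP 0 m; rewrite iter_half ler_pdivrMr ?exprn_gt0 // mul1r -natrX ler_nat.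
  by apply: (sparsifies_le ml _ (@sparsifies_log _)); rewrite leq_mul2l /= leqnSn.
have [C' h] := sparsifies_iter (@alphan_log k) IH; exists C' => m; rewrite hopsS; apply: h.
by have := alphanP k.+1 m; rewrite iter_alphan lern1.
Qed.

Lemma num_edges_symE (V : finType) (E : {set V * V}) : (num_edges (symE E) <= #|E|)%N.
Proof.
pose f (e : V * V) := (finset.set1 e.1 :|: finset.set1 e.2)%SET.
apply: leq_trans (leq_imset_card f E); apply/subset_leq_card/fintype.subsetP => e.
rewrite inE => /existsP[u /existsP[v /andP[/orP[uv|uv] /eqP->]]].
  by apply/imsetP; exists (u, v).
by apply/imsetP; exists (v, u) => //; rewrite /f finset.setUC.
Qed.

Theorem theorem6 :
  forall k : nat, (2 <= k)%N ->
  exists C : R, 0 < C /\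
    forall (V : finType) (G : rel V), string_graph G ->
      exists H : rel V,
        hop_spanner G H ((3 * (5 ^ k - 1)) %/ 4)%N /\
        (num_edges H)%:R <= C * (#|V|%:R) * alpha k (#|V|%:R).
Proof.
move=> [//|k] _; have [C spars] := sparsifies_alphan k.
(* The factor 2 absorbs the successor in [(alphan k m).+1] once [alphan k m] is positive; adding 1
   makes the constant positive. *)
exists (2 * C + 1)%:R; split=> [|V G sG]; first by rewrite ltr0n addn1.
have sT := string_graph_stringlike (@finset.setTfor V) sG.
have Gsym := stringlike_sym sT.
have [|E [inE cE cov]] := spars #|V| V G _ sT; first by move=> C' _ _; apply: max_card.
exists (symE E); split; first split.
- by move=> u v; rewrite /symE /= orbC.
- split=> [u v /orP[/inE//|/inE]|u v uv]; first by rewrite Gsym.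
  by apply: cov; rewrite ?finset.inE.
rewrite -[alpha k.+1 _]/((alphan k #|V|)%:R) -!natrM ler_nat.
apply: leq_trans (num_edges_symE E) _.
(* With at most one vertex the claimed bound can be 0, so [E] has to be shown empty. *)
case: (leqP #|V| 1) => V1; last first.
  by apply: leq_trans cE _; rewrite finset.cardsT; have := alphan_gt0 k V1; nia.
rewrite (_ : #|E| = 0%N) //; apply/eqP; rewrite finset.cards_eq0; apply/eqP/finset.setP => -[u v].
rewrite finset.inE; apply/negP => /inE.
by rewrite (fintype_le1P V1 u v) (stringlike_irr sT).
Qed.
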